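(* Let $a,b$ be relatively prime positive integers such that the zeta map $\zeta:\mathfrak{D}_{a,b}\to\mathfrak{D}_{a,b}$ is a bijection, and let $n$ be a nonnegative integer no bigger than the number of boxes above the main diagonal in the $a\times b$ grid. Then the left-justified partition $\lambda^n$ and the up-justified partition $\nu^n$ are related by the conjugate-area map: $$\chi(\lambda^n)=\nu^n.$$ Moreover, $\zeta^{-1}(\lambda^n)$ (i.e. $\zeta^{-1}$ of the $(a,b)$-Dyck path bounding $\lambda^n$) is the $(a,b)$-Dyck path of area $n$ whose positive hooks are the $n$ smallest positive hooks occurring in the grid.
   Context: An $(a,b)$-Dyck path is a lattice path from $(0,0)$ to $(b,a)$ with unit north steps and unit east steps, all of whose lattice points $(x,y)$ satisfy $ax\le by$; it is drawn in the grid with $a$ rows and $b$ columns. $\mathfrak{D}_{a,b}$ is the set of all of them. The main diagonal is the segment from $(0,0)$ to $(b,a)$. Hooks and cores: the unit box with southeast corner $(x,y)$ has hook filling $by-ax$ (a box lies above the main diagonal iff its hook is positive). The positive hooks of $P$ are the positive hook fillings of the boxes of the grid lying below (southeast of) $P$; $\mathrm{area}(P)$ is the number of positive hooks of $P$. $\mathfrak{c}(P)$ is the partition whose set of first-column hook lengths is the set of positive hooks of $P$ (it has no hook length equal to $a$ or $b$). For a partition $\kappa$ and a positive integer $m$: consider the hook lengths of the boxes in the first column of $\kappa$; for each residue modulo $m$ that occurs take the largest such hook length; the rows of $\kappa$ with these first-column hook lengths are the $m$-rows. The $m$-boundary of $\kappa$ is the set of boxes with hook length less than $m$. Zeta: the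 partition bounded by a path is the partition whose Young diagram (English notation) is the set of boxes of the grid above (northwest of) the path. $\lambda(P)=(\lambda_1\ge\dots\ge\lambda_a)$ has as parts the numbers of $b$-boundary boxes in the $a$-rows of $\mathfrak{c}(P)$ (padded with zeros). $\zeta(P)$ is the $(a,b)$-Dyck path bounding $\lambda(P)$. Conjugation: $P^c$ is obtained by applying cyclic shifts to the step sequence of $P$ until a path lying strictly below the diagonal (except at its two endpoints) is obtained (there is exactly one such cyclic shift), and rotating this path by $180^\circ$. The conjugate-area map is $\chi(Q)=\zeta\big((\zeta^{-1}(Q))^c\big)$; for a partition $\lambda$ bounded by $Q\in\mathfrak{D}_{a,b}$, $\chi(\lambda)$ denotes the partition bounded by $\chi(Q)$. Justified partitions: among partitions whose Young diagram, placed in the upper-left corner of the $a\times b$ grid, consists of boxes above the main diagonal, $\lambda^n$ is the one with $n$ boxes as far to the left as possible (fill the columns of boxes above the diagonal one after another from left to right, each from top to bottom, until $n$ boxes are used), and $\nu^n$ is the one with $n$ boxes as far up as possible (fill the rows of boxes above the diagonal one after another from top to bottom, each from left to right, until $n$ boxes are used). *)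

(* Defs.v *)
From HB Require Import structures.
From mathcomp Require Import all_boot.

Set Implicit Arguments.
Unset Strict Implicit.
Unset Printing Implicit Defensive.

(* Lattice paths are words over [bool]: [true] is a unit north step, [false]
   a unit east step. *)
Definition north (w : seq bool) : nat := count id w.
Definition east (w : seq bool) : nat := count negb w.

Definition is_dyck (a b : nat) (w : seq bool) : bool :=
  [&& north w == a, east w == b &
      all (fun i => a * east (take i w) <= b * north (take i w))
          (iota 0 (size w).+1)].

Record dyck (a b : nat) : predArgType := Dyck {
  steps :> (a + b).-tuple bool;
  _ : is_dyck a b steps }.

HB.instance Definition _ (a b : nat) := [isSub for @steps a b].
HB.instance Definition _ (a b : nat) := [Finite of dyck a b by <:].

(* Partitions inside the grid are given by their row lengths from top to
   bottom, padded with zeros to length [a].  The row at height [y] (between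
   ordinates [y] and [y.+1]) has as many boxes to the left of the path as there
   are east steps before the north step of that row. *)
Definition row_lengths (w : seq bool) : seq nat :=
  [seq east (take i w) | i <- iota 0 (size w) & nth false w i].
Definition bounded (w : seq bool) : seq nat := rev (row_lengths w).

Lemma row_lengths_cons (c : bool) (w : seq bool) :
  row_lengths (c :: w) =
  if c then 0 :: row_lengths w else [seq l.+1 | l <- row_lengths w].
Proof.
have E (r : seq nat) : [seq east (take i (c :: w)) | i <- [seq i.+1 | i <- r]
      & nth false (c :: w) i]
    = [seq ~~ c + east (take i w) | i <- r & nth false w i].
  by rewrite filter_map -map_comp.
rewrite /row_lengths /= (iotaDl 1 0) (eq_map (add1n)).
case: c E => E /=; rewrite E; first by congr cons; exact: eq_map.
by rewrite -map_comp; exact: eq_map.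
Qed.

Lemma row_lengths_inj (w w' : seq bool) :
  size w = size w' -> row_lengths w = row_lengths w' -> w = w'.
Proof.
elim: w w' => [|c w IHw] [|c' w'] //= [sz_w].
rewrite !row_lengths_cons; case: c; case: c'.
- by case=> /IHw ->.
- by case: (row_lengths w').
- by case: (row_lengths w).
- by move/(inj_map succn_inj)/IHw => ->.
Qed.

Lemma bounded_inj (a b : nat) (P Q : dyck a b) : bounded P = bounded Q -> P = Q.
Proof.
move/(can_inj revK)/row_lengths_inj; rewrite !size_tuple => /(_ erefl) eqPQ.
by apply/val_inj/val_inj.
Qed.

(* A box is represented by its southeast corner [(x, y)], 1 <= x <= b and
   0 <= y < a.  The hook filling [b * y - a * x] is only ever used for boxes
   above the diagonal, so truncated subtraction is harmless. *)
Definition above_diag (a b : nat) (s : nat * nat) : bool := a * s.1 < b * s.2.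
Definition hook_filling (a b : nat) (s : nat * nat) : nat :=
  b * s.2 - a * s.1.

Definition boxes_by_columns (a b : nat) : seq (nat * nat) :=
  [seq s <- [seq (x, y) | x <- iota 1 b, y <- rev (iota 0 a)]
     | above_diag a b s].
Definition boxes_by_rows (a b : nat) : seq (nat * nat) :=
  [seq s <- [seq (x, y) | y <- rev (iota 0 a), x <- iota 1 b]
     | above_diag a b s].

Definition below_path (w : seq bool) (s : nat * nat) : bool :=
  nth 0 (row_lengths w) s.2 < s.1.

Definition grid_hooks (a b : nat) : seq nat :=
  [seq hook_filling a b s | s <- boxes_by_rows a b].
Definition positive_hooks (a b : nat) (w : seq bool) : seq nat :=
  [seq hook_filling a b s | s <- boxes_by_rows a b & below_path w s].
Definition area (a b : nat) (w : seq bool) : nat := size (positive_hooks a b w).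

(* Hook length of the box in row [i] and column [j] (both from 0) of the
   partition [k], for [j < nth 0 k i]: arm + leg + 1. *)
Definition hook_length (k : seq nat) (i j : nat) : nat :=
  (nth 0 k i - j.+1) + (count (fun p => j < p) k - i.+1) + 1.

Definition first_column_hooks (k : seq nat) : seq nat :=
  [seq hook_length k i 0 | i <- iota 0 (size k)].

(* If h_0 > ... > h_(r-1) are the first-column hook lengths of a partition with
   r rows, then its row i has length h_i - (r - 1 - i); see
   [first_column_hooksK]. *)
Definition partition_of_hooks (h : seq nat) : seq nat :=
  [seq nth 0 (sort geq h) i - (size h - i.+1) | i <- iota 0 (size h)].

Lemma first_column_hooksK (h : seq nat) :
  uniq h -> all (leq 1) h ->
  first_column_hooks (partition_of_hooks h) = sort geq h.
Proof.
move=> Uh Ph; set s := sort geq h.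
have sz_s : size s = size h by rewrite size_sort.
have Us : uniq s by rewrite sort_uniq.
have geq_trans : transitive geq by move=> y x z; rewrite /geq /= => yx /leq_trans->.
have Ss : sorted geq s by apply: sort_sorted => x y; exact: leq_total.
have Ps i : i < size h -> 0 < nth 0 s i.
  move=> lt_i; have : nth 0 s i \in h by rewrite -(mem_sort geq) mem_nth ?sz_s.
  by move/(allP Ph).
have lb d i : i + d.+1 = size h -> d < nth 0 s i.
  elim: d i => [|d IHd] i def_d; first by apply: Ps; rewrite -def_d addn1.
  have lt_i1 : i.+1 < size h by rewrite -def_d !addnS !ltnS leq_addr.
  apply: leq_ltn_trans (IHd i.+1 _) _; first by rewrite addSnnS.
  rewrite ltn_neqAle nth_uniq ?sz_s ?(ltnW lt_i1) // gtn_eqF //=.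
  by apply: (sorted_ltn_nth geq_trans 0 Ss); rewrite ?inE ?sz_s // ltnW.
have lbi i : i < size h -> size h - i.+1 < nth 0 s i.
  by move=> lt_i; apply: lb; rewrite -subSn // subSS subnKC // ltnW.
have sz_p : size (partition_of_hooks h) = size h by rewrite size_map size_iota.
have nth_p i : i < size h ->
    nth 0 (partition_of_hooks h) i = nth 0 s i - (size h - i.+1).
  by move=> lt_i; rewrite (nth_map 0) ?size_iota // nth_iota.
have cnt : count (leq 1) (partition_of_hooks h) = size h.
  rewrite -sz_p; apply/eqP; rewrite -all_count; apply/(all_nthP 0) => i.
  by rewrite sz_p => lt_i; rewrite nth_p // subn_gt0 lbi.
apply: (@eq_from_nth _ 0) => [|i]; rewrite size_map size_iota sz_p ?sz_s //.
move=> lt_i; rewrite (nth_map 0) ?size_iota ?sz_p // nth_iota ?sz_p //.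
rewrite /hook_length add0n cnt nth_p // addnAC subn1 addn1 prednK.
  by rewrite subnK // ltnW // lbi.
by rewrite subn_gt0 lbi.
Qed.

Definition core (a b : nat) (w : seq bool) : seq nat :=
  partition_of_hooks (positive_hooks a b w).

Definition is_mrow (m : nat) (k : seq nat) (i : nat) : bool :=
  all (fun h => (h == hook_length k i 0 %[mod m]) ==> (h <= hook_length k i 0))
      (first_column_hooks k).

Definition boundary_in_row (m : nat) (k : seq nat) (i : nat) : nat :=
  count (fun j => hook_length k i j < m) (iota 0 (nth 0 k i)).

Definition pad (m : nat) (k : seq nat) : seq nat := k ++ nseq (m - size k) 0.

Definition zeta_partition (a b : nat) (w : seq bool) : seq nat :=
  let k := core a b w in
  pad a (sort geq
    [seq boundary_in_row b k i | i <- iota 0 (size k) & is_mrow a k i]).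

Definition strictly_below_diag (a b : nat) (w : seq bool) : bool :=
  all (fun i => b * north (take i w) < a * east (take i w))
      (iota 1 (size w).-1).

Definition left_justified (a b n : nat) : seq nat :=
  [seq count (fun s => s.2 == y) (take n (boxes_by_columns a b))
     | y <- rev (iota 0 a)].
Definition up_justified (a b n : nat) : seq nat :=
  [seq count (fun s => s.2 == y) (take n (boxes_by_rows a b))
     | y <- rev (iota 0 a)].

Definition smallest_hooks (a b n : nat) : seq nat :=
  take n (sort leq (grid_hooks a b)).

Section DyckMaps.

Variables a b : nat.

(* The Dyck path bounding [zeta_partition a b P]: at most one such path exists
   by [bounded_inj], and for coprime [a] and [b] there always is one, so that
   the default value is not used. *)
Definition zeta (P : dyck a b) : dyck a b :=
  odflt P [pick Q : dyck a b | bounded Q == zeta_partition a b P].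

(* Rotation by 180 degrees reverses the step sequence.  For coprime positive
   [a] and [b] exactly one cyclic shift of [P] is strictly below the diagonal,
   so that the default value is not used. *)
Definition conjugate (P : dyck a b) : dyck a b :=
  odflt P [pick Q : dyck a b |
    [exists i : 'I_(a + b),
       strictly_below_diag a b (rot i P) && (rev (rot i P) == Q)]].

Definition zeta_inv (zeta_bij : bijective zeta) : dyck a b -> dyck a b :=
  invF (bij_inj zeta_bij).

Definition chi (zeta_bij : bijective zeta) (Q : dyck a b) : dyck a b :=
  zeta (conjugate (zeta_inv zeta_bij Q)).

End DyckMaps.

(* Main.v *)
From HB Require Import structures.
Require Import Defs.
From mathcomp Require Import all_boot.
From mathcomp Require Import zify.

(** The positive hook fillings of the grid are the gaps of the numerical
    semigroup S generated by [a] and [b], i.e. the nonnegative integers that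
    are not sums of multiples of [a] and [b].  The positive hooks of a path
    form a set of gaps that contains every gap obtained from one of its members
    by subtracting [a] or [b], and any such set comes from exactly one path.  In
    particular the [n] smallest gaps, which are the gaps up to some bound t, are
    the positive hooks of a path P.

    If h is a first-column hook length of a partition with set H of first-column
    hook lengths, the hook lengths in its row are the numbers h - g with g < h
    outside H, so the row has as many b-boundary boxes as there are such g in
    the window of the [b - 1] integers below h ([boundary_in_rowE]).

    For P this counts the elements of S in the window.  Each residue class
    modulo [b] has a least element i * a of S with i < b and meets the window
    at most once, so the count is the number of multiples of [a] up to h,
    namely h %/ a + 1 ([row_boundary_truncation]).  Hence exactly as many rows
    of the zeta partition have more than j boxes as there are hooks h of P with
    h %/ a = j ([class_max_count]).  On the other side, along each row of the
    grid the quotients of the hooks by [a] and the column indices take the same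
    values in opposite orders.  So listing the gaps in increasing order goes
    through the columns of the grid from left to right, with the right number of
    gaps for each column ([columns_hooks]), and the zeta partition of P is the
    left-justified one.

    The conjugate path Q starts at the highest level that P reaches, and its
    hooks are the numbers M - u > 0, where M is the largest hook of P and u runs
    over the nonnegative integers that are not hooks of P
    ([mem_hooks_conjugate]).  The a-rows of its core are those of the hooks
    M - j * b, and the window below M - j * b is turned by u = M - g into the
    integers strictly between j * b and j * b + b.  So the row has as many
    b-boundary boxes as P has hooks h with h %/ b = j ([row_boundary_conj]).
    Exchanging [a] and [b] transposes the grid and turns columns into rows, so
    that these are the row lengths of the up-justified partition
    ([take_rows_count]). *)

Set Implicit Arguments.
Unset Strict Implicit.
Unset Printing Implicit Defensive.

(** * Words, rows and paths *)

Lemma northD w1 w2 : north (w1 ++ w2) = north w1 + north w2.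
Proof. exact: count_cat. Qed.

Lemma eastD w1 w2 : east (w1 ++ w2) = east w1 + east w2.
Proof. exact: count_cat. Qed.

Lemma north_east_size w : north w + east w = size w.
Proof. exact: (count_predC id). Qed.

Lemma size_row_lengths w : size (row_lengths w) = north w.
Proof.
elim: w => [|c w IHw] //; rewrite row_lengths_cons.
by case: c; [rewrite /= IHw | rewrite (size_map succn) IHw].
Qed.

Lemma north_take_lt w i :
  i < size w -> nth false w i -> north (take i w) < north w.
Proof.
move=> lt_i w_i; rewrite -{2}(cat_take_drop i w) northD (drop_nth false) // w_i.
by rewrite /north /= add1n addnS leq_addr.
Qed.

Lemma nth_row_lengths w i :
  i < size w -> nth false w i ->
  nth 0 (row_lengths w) (north (take i w)) = east (take i w).
Proof.
elim: w i => [|c w IHw] [|i] //=; first by rewrite row_lengths_cons; case: c.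
rewrite ltnS => lt_i w_i; rewrite row_lengths_cons /north /east /=.
case: c => /=; rewrite ?add0n ?add1n /=; first exact: IHw.
rewrite (nth_map 0) ?IHw // size_row_lengths.
exact: north_take_lt.
Qed.

Lemma north_stepP w y : y < north w ->
  exists i, [/\ i < size w, nth false w i & north (take i w) = y].
Proof.
elim: w y => [|c w IHw] y //; case: c => /= lt_y; last first.
  by have [i [? ? ?]] := IHw y lt_y; exists i.+1.
case: y lt_y => [|y]; first by exists 0.
rewrite /north /= add1n ltnS => /IHw [i [? ? <-]].
by exists i.+1; split.
Qed.

Lemma east_leq w i j : i <= j -> east (take i w) <= east (take j w).
Proof.
move=> le_ij; rewrite -[take j w](cat_take_drop i) eastD take_takel //.
exact: leq_addr.
Qed.

Lemma north_leq w i j : i <= j -> north (take i w) <= north (take j w).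
Proof.
move=> le_ij; rewrite -[take j w](cat_take_drop i) northD take_takel //.
exact: leq_addr.
Qed.

(** Among the lattice points at a given height, the one at the start of the
    north step is the furthest to the right, so only these starts need to be
    compared with the diagonal. *)
Lemma is_dyck_rows a b w : north w = a -> east w = b ->
  (forall y, y < a -> a * nth 0 (row_lengths w) y <= b * y) -> is_dyck a b w.
Proof.
move=> nw ew le_w; apply/and3P; split; rewrite ?nw ?ew //; apply/allP => i _.
have [lt_y|ge_y] := ltnP (north (take i w)) a; last first.
  have: east (take i w) <= b.
    by rewrite -ew -{2}(cat_take_drop i w) eastD leq_addr.
  nia.
have [j [lt_j w_j n_j]] : exists j, [/\ j < size w, nth false w j
    & north (take j w) = north (take i w)] by apply: north_stepP; rewrite nw.
have e_j := nth_row_lengths lt_j w_j.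
have le_ij : i <= j.
  rewrite leqNgt; apply/negP => lt_ji.
  have := north_leq w lt_ji; rewrite (take_nth false) // w_j -cats1 northD n_j /=.
  by rewrite /north /= addn0 addn1 ltnn.
have := le_w _ lt_y; rewrite -n_j e_j; apply: leq_trans.
by rewrite leq_mul2l east_leq ?orbT.
Qed.

Section Dyck.
Variables (a b : nat) (P : dyck a b).

Lemma dyck_north : north P = a.
Proof. by case: P => s /= /and3P[/eqP]. Qed.

Lemma dyck_east : east P = b.
Proof. by case: P => s /= /and3P[_ /eqP]. Qed.

Lemma dyck_prefix i : a * east (take i P) <= b * north (take i P).
Proof.
have /and3P[_ _ /allP le_P] := valP P.
have [lt_i|ge_i] := ltnP i (size P).+1; first by apply: le_P; rewrite mem_iota.
by rewrite take_oversize ?(ltnW ge_i) // dyck_north dyck_east mulnC.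
Qed.

Lemma dyck_row y : y < a -> a * nth 0 (row_lengths P) y <= b * y.
Proof.
rewrite -{1}dyck_north => /north_stepP[i [lt_i P_i <-]].
by rewrite nth_row_lengths ?dyck_prefix.
Qed.
End Dyck.

(** [p] is the abscissa already reached, and [rows] lists from bottom to top the
    abscissas of the north steps that are still to come. *)
Fixpoint path_of_rows (b p : nat) (rows : seq nat) : seq bool :=
  if rows is m :: rows' then nseq (m - p) false ++ true :: path_of_rows b m rows'
  else nseq (b - p) false.

Lemma row_lengths_nseq k w :
  row_lengths (nseq k false ++ w) = [seq k + l | l <- row_lengths w].
Proof.
elim: k => [|k IHk]; first by rewrite -[LHS]map_id; apply: eq_map => l.
by rewrite [LHS]row_lengths_cons IHk -map_comp; apply: eq_map.
Qed.

Lemma row_lengths_path_of_rows b p rows : path leq p rows ->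
  row_lengths (path_of_rows b p rows) = [seq m - p | m <- rows].
Proof.
elim: rows p => [|m rows IHr] p /=.
  by rewrite -[nseq _ _]cats0 row_lengths_nseq.
case/andP=> le_pm pr; rewrite row_lengths_nseq row_lengths_cons /= addn0 IHr //.
congr cons; rewrite -map_comp; apply/eq_in_map => l l_r /=.
by have /allP/(_ _ l_r) := order_path_min leq_trans pr; lia.
Qed.

Lemma north_path_of_rows b p rows : north (path_of_rows b p rows) = size rows.
Proof.
have nn k : north (nseq k false) = 0 by rewrite /north count_nseq mul0n.
by elim: rows p => [|m rows IHr] p /=; rewrite ?northD nn // -(IHr m).
Qed.

Lemma east_path_of_rows b p rows :
  path leq p rows -> all (geq b) rows -> east (path_of_rows b p rows) = b - p.
Proof.
have en k : east (nseq k false) = k by rewrite /east count_nseq mul1n.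
elim: rows p => [|m rows IHr] p /=; rewrite ?eastD en //.
case/andP=> le_pm pr /andP[le_mb le_r].
have := IHr m pr le_r; rewrite /east /= => ->; move: le_mb; rewrite /geq /=; lia.
Qed.

Lemma dyck_of_rows a b (f : nat -> nat) : 0 < a ->
  (forall y, y.+1 < a -> f y <= f y.+1) -> (forall y, y < a -> a * f y <= b * y) ->
  exists P : dyck a b, row_lengths P = [seq f y | y <- iota 0 a].
Proof.
move=> a_gt0 f_mono f_diag; set rows := map f _; set w := path_of_rows b 0 rows.
have nth_rows y : y < a -> nth 0 rows y = f y.
  by move=> lt_y; rewrite (nth_map 0) ?size_iota // nth_iota.
have rows_path : path leq 0 rows.
  rewrite path_min_sorted; last by apply/allP.
  apply/(sortedP 0) => y; rewrite size_map size_iota => lt_y.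
  by rewrite !nth_rows ?f_mono // ltnW.
have le_b : all (geq b) rows.
  apply/(all_nthP 0) => y; rewrite size_map size_iota => lt_y.
  have := f_diag y lt_y; rewrite nth_rows //=; nia.
have rw : row_lengths w = rows.
  by rewrite row_lengths_path_of_rows // -[RHS]map_id; apply: eq_map => m; rewrite subn0.
have nw : north w = a by rewrite north_path_of_rows size_map size_iota.
have ew : east w = b by rewrite east_path_of_rows ?subn0.
have sw : size w == a + b by rewrite -north_east_size nw ew.
have dw : is_dyck a b (Tuple sw).
  by apply: is_dyck_rows => // y lt_y; rewrite rw nth_rows ?f_diag.
by exists (Dyck dw).
Qed.

(** * Hooks and gaps of the numerical semigroup *)

(** Positivity of the hook already confines a box of a row of the grid to the
    [b] columns, so the bound on the abscissa can be left out of membership. *)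
Lemma box_col_leq a b x y : y < a -> a * x < b * y -> x <= b.
Proof.
move=> lt_y lt_xy; rewrite leqNgt; apply/negP => lt_bx.
have : b * y <= a * x by rewrite mulnC leq_mul // ltnW.
by rewrite leqNgt lt_xy.
Qed.

Lemma mem_boxes_by_rows a b x y :
  ((x, y) \in boxes_by_rows a b) = [&& 0 < x, y < a & a * x < b * y].
Proof.
rewrite mem_filter /above_diag /=; apply/andP/and3P.
  case=> lt_xy /allpairsP[[y' x'] /= []]; rewrite mem_rev !mem_iota.
  by move=> y'P x'P [? ?]; subst; split=> //; lia.
case=> x_gt0 lt_y lt_xy; split=> //; apply/allpairsP; exists (y, x).
by rewrite mem_rev !mem_iota x_gt0 lt_y add1n ltnS (box_col_leq lt_y lt_xy).
Qed.

Lemma mem_boxes_by_columns a b x y :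
  ((x, y) \in boxes_by_columns a b) = [&& 0 < x, y < a & a * x < b * y].
Proof.
rewrite mem_filter /above_diag /=; apply/andP/and3P.
  case=> lt_xy /allpairsP[[x' y'] /= []]; rewrite mem_rev !mem_iota.
  by move=> y'P x'P [? ?]; subst; split=> //; lia.
case=> x_gt0 lt_y lt_xy; split=> //; apply/allpairsP; exists (x, y).
by rewrite mem_rev !mem_iota x_gt0 lt_y add1n ltnS (box_col_leq lt_y lt_xy).
Qed.

Lemma uniq_boxes_by_rows a b : uniq (boxes_by_rows a b).
Proof.
apply/filter_uniq/allpairs_uniq; rewrite ?rev_uniq ?iota_uniq //.
by move=> [y x] [y' x'] _ _ [-> ->].
Qed.

Lemma uniq_boxes_by_columns a b : uniq (boxes_by_columns a b).
Proof.
apply/filter_uniq/allpairs_uniq; rewrite ?rev_uniq ?iota_uniq //.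
by move=> [y x] [y' x'] _ _ [-> ->].
Qed.

Lemma positive_hooksP a b w v :
  reflect (exists x y, [/\ nth 0 (row_lengths w) y < x, y < a, 0 < v
                         & v + a * x = b * y])
          (v \in positive_hooks a b w).
Proof.
apply: (iffP mapP) => [[[x y]]|[x [y [lt_x lt_y v_gt0 def_v]]]].
  rewrite mem_filter /below_path mem_boxes_by_rows /hook_filling /=.
  by case/and4P=> ? ? ? ? ->; exists x, y; split=> //; lia.
exists (x, y); last by rewrite /hook_filling /=; lia.
by rewrite mem_filter /below_path mem_boxes_by_rows lt_x lt_y /=; lia.
Qed.

Lemma grid_hooksP a b v :
  reflect (exists x y, [/\ 0 < x, y < a, 0 < v & v + a * x = b * y])
          (v \in grid_hooks a b).
Proof.
apply: (iffP mapP) => [[[x y]]|[x [y [x_gt0 lt_y v_gt0 def_v]]]].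
  rewrite mem_boxes_by_rows /hook_filling /=.
  by case/and3P=> ? ? ? ->; exists x, y; split=> //; lia.
exists (x, y); last by rewrite /hook_filling /=; lia.
by rewrite mem_boxes_by_rows x_gt0 lt_y /=; lia.
Qed.

Section Coprime.

Variables a b : nat.
Hypotheses (a_gt0 : 0 < a) (b_gt0 : 0 < b) (coprime_ab : coprime a b).

(** The hooks in row [y] are congruent to [b * y] modulo [a], so by coprimality
    the row of a hook can be read off its residue. *)
Lemma mulb_modn_inj y y' : y < a -> y' < a -> b * y = b * y' %[mod a] -> y = y'.
Proof.
wlog le_yy': y y' / y <= y' => [IH|] lt_y lt_y' eq_m.
  by case/orP: (leq_total y y') => le_y; [|symmetry]; apply: IH.
have : a %| b * y' - b * y by rewrite -eqn_mod_dvd ?leq_mul2l ?le_yy' ?orbT ?eq_m.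
rewrite -mulnBr Gauss_dvdr // => /dvdn_leq; lia.
Qed.

Lemma hook_eq_inj x y x' y' v :
  y < a -> y' < a -> v + a * x = b * y -> v + a * x' = b * y' -> (x, y) = (x', y').
Proof.
move=> lt_y lt_y' def_v def_v'; have eq_y : y = y'.
  by apply: mulb_modn_inj => //; rewrite -def_v -def_v' !(addnC v) !(mulnC a) !modnMDl.
congr pair => //; subst y'; have /eqP : a * x = a * x' by lia.
by rewrite eqn_pmul2l // => /eqP.
Qed.

Lemma uniq_grid_hooks : uniq (grid_hooks a b).
Proof.
rewrite map_inj_in_uniq ?uniq_boxes_by_rows // => -[x y] [x' y'].
rewrite !mem_boxes_by_rows /hook_filling /= => /and3P[_ ? ?] /and3P[_ ? ?] eq_h.
by apply: (@hook_eq_inj _ _ _ _ (b * y - a * x)); lia.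
Qed.

Lemma uniq_positive_hooks w : uniq (positive_hooks a b w).
Proof.
have /subseq_uniq -> // := uniq_grid_hooks.
by apply: map_subseq; exact: filter_subseq.
Qed.

Lemma row_of_residue v : exists2 y, y < a & b * y = v %[mod a].
Proof.
pose c := chinese a b v 0; have c_a : c = v %[mod a] by exact: chinese_modl.
have /dvdnP[y def_c] : b %| c.
  by rewrite /dvdn chinese_modr // mod0n.
exists (y %% a); first exact: ltn_pmod.
by rewrite modnMmr mulnC -def_c.
Qed.

(** Every number [v] lies on exactly one of the arithmetic progressions of
    difference [a] through the values [b * y], either at or above [b * y], and
    then it is in the semigroup, or below it, and then it is a hook if [v > 0]. *)
Lemma residue_cases v : exists y, y < a /\
  ((exists k, v = b * y + k * a) \/ (exists k, v + a * k.+1 = b * y)).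
Proof.
have [y lt_y eq_m] := row_of_residue v; exists y; split=> //.
have [le_v|lt_v] := leqP (b * y) v.
  left; exists ((v - b * y) %/ a); rewrite divnK ?subnKC // -eqn_mod_dvd //.
  by rewrite eq_m.
right; exists ((b * y - v) %/ a).-1; have dv : a %| b * y - v.
  by rewrite -eqn_mod_dvd 1?ltnW // eq_m.
rewrite prednK; last by rewrite divn_gt0 // dvdn_leq // subn_gt0.
by rewrite mulnC divnK // subnKC // ltnW.
Qed.

(** If [v] is the hook [b * y - a * x] and also [i * a + j * b], then [j] and [y]
    are congruent modulo [a] and less than [a], hence equal, which leaves
    [(i + x) * a = 0] although [x > 0]. *)
Lemma grid_hook_not_sum v i j : v \in grid_hooks a b -> v <> i * a + j * b.
Proof.
case/grid_hooksP=> x [y [x_gt0 lt_y v_gt0 def_v]] eq_v.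
have lt_j : j < a by nia.
have eq_by : b * y = (i + x) * a + b * j by rewrite -def_v eq_v; lia.
have eq_y : y = j by apply: mulb_modn_inj => //; rewrite eq_by modnMDl.
nia.
Qed.

Lemma not_grid_hook_sum v : v \notin grid_hooks a b ->
  exists i j, j < a /\ v = i * a + j * b.
Proof.
move=> notGv; have [y [lt_y [[k ->]|[k def_v]]]] := residue_cases v.
  by exists k, y; split=> //; rewrite addnC (mulnC b).
have [v0|v_gt0] := posnP v; first by exists 0, 0.
by case/grid_hooksP: notGv; exists k.+1, y.
Qed.

End Coprime.

(** The hooks of the grid are the numbers outside the semigroup, which does not
    depend on the order of its generators. *)
Lemma mem_grid_hooks_sym a b v : 0 < a -> 0 < b -> coprime a b ->
  (v \in grid_hooks a b) = (v \in grid_hooks b a).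
Proof.
suff sub a' b' : 0 < a' -> 0 < b' -> coprime a' b' ->
    v \in grid_hooks a' b' -> v \in grid_hooks b' a'.
  by move=> a0 b0 cab; apply/idP/idP; apply: sub; rewrite // coprime_sym.
move=> a0 b0 cab vG; apply/contraT => /not_grid_hook_sum[]; rewrite 1?coprime_sym //.
move=> i [j [_ def_v]].
by have [] := grid_hook_not_sum a0 b0 cab (i := j) (j := i) vG; rewrite addnC.
Qed.

(** * Levels of a path *)

(** Lattice points on the diagonal have level 0, and a north step raises the
    level by [b] while an east step lowers it by [a].  On a Dyck path levels are
    nonnegative, so the truncated subtraction is exact ([levelE]). *)
Definition level (a b : nat) (w : seq bool) (i : nat) : nat :=
  b * north (take i w) - a * east (take i w).

Section Levels.

Variables a b : nat.
Hypotheses (a_gt0 : 0 < a) (b_gt0 : 0 < b) (coprime_ab : coprime a b).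
Implicit Type P : dyck a b.

Lemma levelE P i : level a b P i + a * east (take i P) = b * north (take i P).
Proof. by rewrite subnK // dyck_prefix. Qed.

Lemma row_step P y : y < a -> exists i, [/\ i < a + b, nth false P i,
  north (take i P) = y & east (take i P) = nth 0 (row_lengths P) y].
Proof.
rewrite -{1}(dyck_north P) => /north_stepP[i [lt_i P_i n_i]].
by exists i; rewrite -n_i nth_row_lengths //; move: lt_i; rewrite size_tuple.
Qed.

(** The box in column east + k + 1 of the row of a north step has the level of
    the start of that step, lowered by k + 1 times [a], as its hook. *)
Lemma hook_levelP P v :
  reflect (0 < v /\ exists i k, [/\ i < a + b, nth false P i
                                  & v + a * k.+1 = level a b P i])
          (v \in positive_hooks a b P).
Proof.
apply: (iffP (positive_hooksP a b P v)).
  case=> x [y [lt_x lt_y v_gt0 def_v]]; split=> //.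
  have [i [lt_i P_i n_i e_i]] := row_step P lt_y.
  exists i, (x - nth 0 (row_lengths P) y).-1.
  by split=> //; have := levelE P i; rewrite n_i e_i; nia.
case=> v_gt0 [i [k [lt_i P_i def_v]]].
rewrite -(size_tuple P) in lt_i; have := levelE P i; have := north_take_lt lt_i P_i.
rewrite dyck_north => lt_n; exists (east (take i P) + k.+1), (north (take i P)).
rewrite nth_row_lengths //; split=> //; lia.
Qed.

(** Start levels of the north steps represent each residue modulo [a] once, and
    in its residue class a start level separates the hooks, strictly below it,
    from the other numbers. *)
Lemma nonhook_levelP P v :
  reflect (exists i k, [/\ i < a + b, nth false P i & v = level a b P i + k * a])
          (v \notin positive_hooks a b P).
Proof.
apply: (iffP idP) => [notHv|[i [k [lt_i P_i def_v]]]]; last first.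
  apply/hook_levelP => -[v_gt0 [i' [k' [lt_i' P_i' def_v']]]].
  rewrite -(size_tuple P) in lt_i lt_i'.
  have lt_n := north_take_lt lt_i P_i; have lt_n' := north_take_lt lt_i' P_i'.
  have e_i := nth_row_lengths lt_i P_i; have e_i' := nth_row_lengths lt_i' P_i'.
  rewrite dyck_north in lt_n lt_n'.
  have l_i := levelE P i; have l_i' := levelE P i'.
  have eq_n : north (take i P) = north (take i' P).
    apply: (mulb_modn_inj a_gt0 b_gt0 coprime_ab) => //.
    rewrite -(modnMDl (k + k'.+1 + east (take i' P))).
    rewrite -[RHS](modnMDl (east (take i P))); congr (_ %% a); lia.
  rewrite eq_n e_i' in e_i; rewrite eq_n -e_i in l_i; nia.
have [y [lt_y cases]] := residue_cases a_gt0 coprime_ab v.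
have [i [lt_i P_i n_i e_i]] := row_step P lt_y.
have := levelE P i; rewrite n_i e_i => l_i; exists i.
case: cases => -[k def_v].
  by exists (k + nth 0 (row_lengths P) y); split=> //; nia.
have [lt_k|le_k] := ltnP (nth 0 (row_lengths P) y) k.+1; last first.
  by exists (nth 0 (row_lengths P) y - k.+1); split=> //; nia.
have [v0|v_gt0] := posnP v; last first.
  by case/positive_hooksP: notHv; exists k.+1, y.
have y0 : y = 0.
  apply: (mulb_modn_inj a_gt0 b_gt0 coprime_ab) => //.
  by rewrite -def_v v0 mulnC modnMl muln0 mod0n.
nia.
Qed.

End Levels.

(** * Cyclic shifts *)

Definition shift_index (N i k : nat) : nat :=
  if i + k < N then i + k else i + k - N.

(** A prefix of the shifted word, after the first [i] letters of [w], is a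
    prefix of [w] followed by [w] again; the conditional term records whether the
    end of [w] has been passed. *)
Lemma count_take_rot (q : pred bool) w i k :
  i <= size w -> k <= size w ->
  count q (take k (rot i w)) + count q (take i w) =
  count q (take (shift_index (size w) i k) w)
    + (if i + k < size w then 0 else count q w).
Proof.
move=> le_i le_k; rewrite /shift_index /rot take_cat size_drop.
case: ltnP => [lt_k|ge_k].
  rewrite (_ : i + k < size w); last by lia.
  by rewrite takeD count_cat addn0 addnC.
rewrite (_ : (i + k < size w) = false); last by lia.
rewrite count_cat take_takel; last by lia.
rewrite -[in RHS](cat_take_drop i w) [in RHS]count_cat cat_take_drop.
by rewrite (_ : k - (size w - i) = i + k - size w); lia.
Qed.

Lemma nth_rot (w : seq bool) i k :
  i <= size w -> k < size w ->
  nth false (rot i w) k = nth false w (shift_index (size w) i k).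
Proof.
move=> le_i lt_k; rewrite /shift_index /rot nth_cat size_drop.
case: ltnP => [lt_k'|ge_k].
  by rewrite nth_drop ifT //; lia.
rewrite ifF; last by lia.
by rewrite nth_take; [congr nth; lia | lia].
Qed.

Section Conjugation.

Variables a b : nat.
Hypotheses (a_gt0 : 0 < a) (b_gt0 : 0 < b) (coprime_ab : coprime a b).
Implicit Type P Q : dyck a b.

Lemma level_rot P i k : i < a + b -> k < a + b ->
  b * north (take k (rot i P)) + level a b P i =
  level a b P (shift_index (a + b) i k) + a * east (take k (rot i P)).
Proof.
move=> lt_i lt_k; have szP := size_tuple P.
have := @count_take_rot id P i k; rewrite szP => /(_ (ltnW lt_i) (ltnW lt_k)).
have := @count_take_rot negb P i k; rewrite szP => /(_ (ltnW lt_i) (ltnW lt_k)).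
rewrite -!/(north _) -!/(east _) dyck_north dyck_east.
have := levelE P i; have := levelE P (shift_index (a + b) i k).
case: ifP => _; nia.
Qed.

(** The levels of the shifted path are those of [P] minus the level at which it
    starts, so the shift stays strictly below the diagonal when it starts at the
    strict maximum of the levels. *)
Lemma strictly_below_rotP P i : i < a + b ->
  reflect (forall j, j < a + b -> j != i -> level a b P j < level a b P i)
          (strictly_below_diag a b (rot i P)).
Proof.
move=> lt_i; have szP := size_tuple P.
apply: (iffP allP) => [below j lt_j neq_ji|top k].
  pose k := if i < j then j - i else j + (a + b) - i.
  have jE : shift_index (a + b) i k = j.
    by rewrite /shift_index /k; case: (ltnP i j); case: ifP; lia.
  have := below k; rewrite mem_iota size_rot szP => /(_ _) below_k.
  have /below_k : 1 <= k < 1 + (a + b).-1 by rewrite /k; case: (ltnP i j); lia.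
  have := @level_rot P i k lt_i; rewrite jE.
  have : k < a + b by rewrite /k; case: (ltnP i j); lia.
  by move=> lt_k /(_ lt_k); lia.
rewrite mem_iota size_rot szP => k_bnd; have lt_k : k < a + b by lia.
have := level_rot P lt_i lt_k; have := top (shift_index (a + b) i k).
have -> : shift_index (a + b) i k < a + b by rewrite /shift_index; case: ifP; lia.
have -> : shift_index (a + b) i k != i by rewrite /shift_index; case: ifP; lia.
by move=> /(_ isT isT); lia.
Qed.

(** Two points at the same level differ by a multiple of (b, a), by coprimality,
    so a strict maximum of the levels exists. *)
Lemma level_inj P i j : i < a + b -> j < a + b ->
  level a b P i = level a b P j -> i = j.
Proof.
have szP := size_tuple P.
wlog le_ij : i j / i <= j => [IH|] lt_i lt_j eq_l.
  by case/orP: (leq_total i j) => le; [|symmetry]; apply: IH.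
have := levelE P i; have := levelE P j => l_j l_i.
have := north_leq P le_ij; have := east_leq P le_ij => le_e le_n.
have : a %| b * (north (take j P) - north (take i P)).
  apply/dvdnP; exists (east (take j P) - east (take i P)); nia.
rewrite Gauss_dvdr // => /dvdnP[k def_k].
have nj : north (take j P) <= a.
  have := north_leq P (ltnW lt_j).
  by rewrite [take (a + b) P]take_oversize ?szP // dyck_north.
have szi : north (take i P) + east (take i P) = i.
  by rewrite north_east_size size_takel // szP ltnW.
have szj : north (take j P) + east (take j P) = j.
  by rewrite north_east_size size_takel // szP ltnW.
have def_e : east (take j P) - east (take i P) = b * k.
  apply/eqP; rewrite -(eqn_pmul2l a_gt0) mulnCA (mulnC a k) -def_k; nia.
have k_le1 : k <= 1 by nia.
by case: k k_le1 def_k def_e => [|[|//]] _; lia.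
Qed.

Lemma rev_rot_dyck P i : i < a + b -> strictly_below_diag a b (rot i P) ->
  is_dyck a b (rev (rot i P)).
Proof.
move=> lt_i /allP below; have szP := size_tuple P; set w := rot i P.
have nw : north w = a.
  exact: etrans (permP (permEl (perm_rot i P)) id) (dyck_north P).
have ew : east w = b.
  exact: etrans (permP (permEl (perm_rot i P)) negb) (dyck_east P).
have nr u : north (rev u) = north u by rewrite /north count_rev.
have er u : east (rev u) = east u by rewrite /east count_rev.
apply/and3P; rewrite nr er nw ew; split=> //; apply/allP => m.
have sw : size w = a + b by rewrite size_rot.
rewrite mem_iota size_rev sw => m_bnd; rewrite take_rev nr er sw.
have := congr1 north (cat_take_drop (a + b - m) w); rewrite northD => n_eq.
have := congr1 east (cat_take_drop (a + b - m) w); rewrite eastD => e_eq.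
have : b * north (take (a + b - m) w) <= a * east (take (a + b - m) w).
  have [->|m_gt0] := posnP m; first by rewrite subn0 -sw take_size nw ew mulnC.
  have [->|m_lt] := eqVneq m (a + b); first by rewrite subnn take0 !muln0.
  by apply/ltnW/below; rewrite mem_iota sw; lia.
rewrite nw in n_eq; rewrite ew in e_eq; nia.
Qed.

(** Rotating by 180 degrees exchanges the two ends of every step: the north
    step of [P] that starts at level [l] becomes a north step that starts at
    the maximal level minus [l + b]. *)
Lemma level_rev_rot P i q :
  i < a + b -> q < a + b -> nth false P (shift_index (a + b) i q) ->
  strictly_below_diag a b (rot i P) ->
  level a b (rev (rot i P)) (a + b - q.+1)
    + level a b P (shift_index (a + b) i q) + b = level a b P i.
Proof.
move=> lt_i lt_q P_q below; have szP := size_tuple P.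
have /and3P[/eqP nr /eqP er /allP dyck_r] := rev_rot_dyck lt_i below.
have sw : size (rot i P) = a + b by rewrite size_rot.
have := dyck_r (a + b - q.+1); rewrite mem_iota size_rev sw => /(_ _) le_r.
have {}le_r := le_r ltac:(lia).
have take_r : take (a + b - q.+1) (rev (rot i P)) = rev (drop q.+1 (rot i P)).
  by rewrite take_rev sw; congr (rev (drop _ _)); lia.
have w_q : nth false (rot i P) q.
  by rewrite nth_rot ?szP // ltnW.
have nrev u : north (rev u) = north u by rewrite /north count_rev.
have erev u : east (rev u) = east u by rewrite /east count_rev.
have split_w : rot i P = take q (rot i P) ++ true :: drop q.+1 (rot i P).
  by rewrite -w_q -drop_nth ?sw // cat_take_drop.
rewrite nrev in nr; rewrite erev in er.
have n_split : a = north (take q (rot i P)) + (1 + north (drop q.+1 (rot i P))).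
  by rewrite -[LHS]nr {1}split_w northD.
have e_split : b = east (take q (rot i P)) + east (drop q.+1 (rot i P)).
  by rewrite -[LHS]er {1}split_w eastD.
have := congr1 (muln b) n_split; have := congr1 (muln a) e_split.
have := level_rot P lt_i lt_q; move: le_r.
rewrite [level a b (rev _) _]/level take_r nrev erev !mulnDr; lia.
Qed.

(** * The positive hooks of the conjugate path *)

Lemma level0 P : level a b P 0 = 0.
Proof. by rewrite /level take0 !muln0. Qed.

Lemma level_end P : level a b P (a + b) = 0.
Proof.
by rewrite /level take_oversize ?size_tuple // dyck_north dyck_east mulnC subnn.
Qed.

Lemma level_step P i : i < a + b ->
  level a b P i.+1 + (if nth false P i then 0 else a)
  = level a b P i + (if nth false P i then b else 0).
Proof.
move=> lt_i; have := levelE P i; have := levelE P i.+1.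
rewrite (take_nth false) ?size_tuple // -cats1 northD eastD.
by case: (nth false P i); rewrite /north /east /= ?(addn0, mulnDr, muln1) //; lia.
Qed.

Lemma conjugateP P : exists2 i, i < a + b &
  strictly_below_diag a b (rot i P) /\ conjugate P = rev (rot i P) :> seq bool.
Proof.
rewrite /conjugate; case: pickP => [Q /existsP[i /andP[below /eqP <-]]|none].
  by exists i.
have ab_gt0 : 0 < a + b by rewrite addn_gt0 a_gt0.
case: (@arg_maxnP _ (Ordinal ab_gt0) xpredT (level a b P)) => // i _ i_max.
have below : strictly_below_diag a b (rot i P).
  apply/strictly_below_rotP => // j lt_j neq_ji.
  have le_ji : level a b P j <= level a b P i := i_max (Ordinal lt_j) isT.
  rewrite ltn_neqAle le_ji andbT.
  by apply: contraNneq neq_ji => /level_inj->.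
have d := rev_rot_dyck (ltn_ord i) below.
have sz : size (rev (rot i P)) == a + b by rewrite size_rev size_rot size_tuple.
have := none (Dyck (d : is_dyck a b (Tuple sz))).
by move/existsP => []; exists i; rewrite below /=.
Qed.

Lemma strict_top_max P i : i < a + b -> strictly_below_diag a b (rot i P) ->
  forall j, j <= a + b -> level a b P j <= level a b P i.
Proof.
move=> lt_i /(strictly_below_rotP P lt_i) top j.
have [->|neq_ji] := eqVneq j i; first by [].
rewrite leq_eqVlt => /predU1P[->|lt_j]; first by rewrite level_end.
by rewrite ltnW // top.
Qed.

(** The highest point is reached by a north step, as an east step would come
    from a higher point. *)
Lemma strict_top_pred P i : i < a + b -> strictly_below_diag a b (rot i P) ->
  exists p, [/\ p < a + b, nth false P p & level a b P i = level a b P p + b].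
Proof.
move=> lt_i below; have top := strict_top_max lt_i below.
case: i lt_i below top => [|p] lt_i below top.
  have /(strictly_below_rotP P lt_i) := below.
  by move/(_ 1); rewrite level0 => /(_ _ isT); lia.
exists p; have := level_step P (ltnW lt_i); have := top p (ltnW (ltnW lt_i)).
by case: (nth false P p) => ? ?; split=> //; lia.
Qed.

Lemma hook_top P i h : i < a + b -> strictly_below_diag a b (rot i P) ->
  h \in positive_hooks a b P -> h + a + b <= level a b P i.
Proof.
move=> lt_i below /(hook_levelP a_gt0 b_gt0 coprime_ab).
case=> h_gt0 [j [k [lt_j P_j def_h]]].
have := strict_top_max lt_i below lt_j; have := level_step P lt_j; rewrite P_j; nia.
Qed.

(** The numbers [u] are the points, in the residue class of a start level of
    [P], at or above it; by [level_rev_rot] they are mirrored to the numbers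
    below the start levels of the conjugate path. *)
Lemma hook_conjugateP P i v : i < a + b -> strictly_below_diag a b (rot i P) ->
  conjugate P = rev (rot i P) :> seq bool ->
  reflect (0 < v /\ exists2 u, u \notin positive_hooks a b P
                            & v + u + a + b = level a b P i)
          (v \in positive_hooks a b (conjugate P)).
Proof.
move=> lt_i below def_Q; have szP := size_tuple P.
have lvl q lt_q P_q := @level_rev_rot P i q lt_i lt_q P_q below.
apply: (iffP (hook_levelP a_gt0 b_gt0 coprime_ab _ v)).
  case=> v_gt0 [m [k [lt_m]]]; rewrite def_Q => Q_m def_v; split=> //.
  (* Step [m] of the reversed word is step [q] of the shifted one. *)
  pose q := a + b - m.+1; have lt_q : q < a + b by rewrite /q; lia.
  rewrite nth_rev ?size_rot ?szP // nth_rot ?szP ?(ltnW lt_i) // in Q_m.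
  have := lvl q lt_q Q_m; rewrite (_ : a + b - q.+1 = m); last by rewrite /q; lia.
  move=> l_m; exists (level a b P (shift_index (a + b) i q) + k * a).
    apply/(nonhook_levelP a_gt0 b_gt0 coprime_ab).
    exists (shift_index (a + b) i q), k; split=> //.
    by rewrite /shift_index; case: ifP; lia.
  lia.
case=> v_gt0 [u /(nonhook_levelP a_gt0 b_gt0 coprime_ab)].
case=> j [k [lt_j P_j ->]] def_v.
(* The index in the shifted word of step [j] of [P]. *)
split=> //; pose q := if i <= j then j - i else j + (a + b) - i.
have lt_q : q < a + b by rewrite /q; case: ifP; lia.
have jE : shift_index (a + b) i q = j.
  by rewrite /shift_index /q; case: (leqP i j); case: ifP; lia.
have := lvl q lt_q; rewrite jE => /(_ P_j) l_m.
exists (a + b - q.+1), k; rewrite def_Q; split; first by lia.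
  rewrite nth_rev ?size_rot ?szP; last by lia.
  rewrite nth_rot ?szP ?(ltnW lt_i) //; last by lia.
  by rewrite (_ : a + b - (a + b - q.+1).+1 = q) ?jE //; lia.
lia.
Qed.

(** The highest level of [P] exceeds its largest hook by [a + b]: the last north
    step before the highest point starts at the largest start level, and the
    largest hook is [a] below that level. *)
Lemma mem_hooks_conjugate P M v :
  M \in positive_hooks a b P -> {in positive_hooks a b P, forall h, h <= M} ->
  (v \in positive_hooks a b (conjugate P))
  = (0 < v <= M) && (M - v \notin positive_hooks a b P).
Proof.
move=> HM maxM; have [i lt_i [below def_Q]] := conjugateP P.
have [p [lt_p P_p def_top]] := strict_top_pred lt_i below.
have topE : level a b P i = M + a + b.
  apply/eqP; rewrite eqn_leq hook_top // andbT def_top leq_add2r.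
  rewrite leqNgt; apply/negP => lt_p_level.
  have : level a b P p - a <= M.
    apply: maxM; apply/(hook_levelP a_gt0 b_gt0 coprime_ab); split; first by lia.
    by exists p, 0; split=> //; lia.
  lia.
apply/(hook_conjugateP v lt_i below def_Q)/andP.
  case=> v_gt0 [u notHu].
  by rewrite topE => eq_u; rewrite (_ : M - v = u); last lia; split=> //; lia.
by case=> v_bnd notHu; split; [lia | exists (M - v) => //; lia].
Qed.

Lemma hooks_conjugate_nil P :
  positive_hooks a b P = [::] -> positive_hooks a b (conjugate P) = [::].
Proof.
move=> H0; have [i lt_i [below def_Q]] := conjugateP P.
have [p [lt_p P_p def_top]] := strict_top_pred lt_i below.
case def_H: positive_hooks => [//|v H'].
have : v \in positive_hooks a b (conjugate P) by rewrite def_H mem_head.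
case/(hook_conjugateP v lt_i below def_Q) => v_gt0 [u _]; rewrite def_top => eq_v.
have : level a b P p - a \in positive_hooks a b P.
  apply/(hook_levelP a_gt0 b_gt0 coprime_ab); split; first by lia.
  by exists p, 0; split=> //; lia.
by rewrite H0.
Qed.

End Conjugation.

(** * Hook lengths of a partition with given first-column hooks *)

Lemma geq_total : total geq.
Proof. by move=> x y; rewrite /geq /= leq_total. Qed.

Lemma geq_trans : transitive geq.
Proof. by move=> y x z; rewrite /geq /= => yx /leq_trans->. Qed.

Lemma geq_anti : antisymmetric geq.
Proof. by move=> x y; rewrite /geq /= => /anti_leq. Qed.

Section Beads.

Variable h : seq nat.
Hypotheses (h_uniq : uniq h) (h_gt0 : all (leq 1) h).

Local Notation s := (sort geq h).
Local Notation k := (partition_of_hooks h).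

Lemma nth_sort_hooks_gap i j : i <= j -> j < size h ->
  nth 0 s j + (j - i) <= nth 0 s i.
Proof.
elim: j => [|j IHj] le_ij lt_j.
  by move: le_ij; rewrite leqn0 => /eqP->; rewrite addn0.
have [->|neq_ij] := eqVneq i j.+1; first by rewrite subnn addn0.
have lt_s : nth 0 s j.+1 < nth 0 s j.
  have /(sortedP 0) : sorted gtn s.
    by rewrite gtn_sorted_uniq_geq sort_uniq h_uniq (sort_sorted geq_total).
  by apply; rewrite size_sort.
have := IHj; lia.
Qed.

Lemma nth_sort_hooks_ge i : i < size h -> size h - i <= nth 0 s i.
Proof.
move=> lt_i; have lt_last : (size h).-1 < size h by lia.
have := nth_sort_hooks_gap (_ : i <= (size h).-1) lt_last.
have : nth 0 s (size h).-1 \in h by rewrite -(mem_sort geq) mem_nth ?size_sort.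
by move/(allP h_gt0); lia.
Qed.

Lemma size_partition_of_hooks : size k = size h.
Proof. by rewrite size_map size_iota. Qed.

Lemma nth_partition_of_hooks i : i < size h ->
  nth 0 k i + (size h - i.+1) = nth 0 s i.
Proof.
move=> lt_i; rewrite (nth_map 0) ?size_iota // nth_iota // add0n.
by have := nth_sort_hooks_ge lt_i; lia.
Qed.

Lemma partition_of_hooks_mono i j : i <= j -> j < size h -> nth 0 k j <= nth 0 k i.
Proof.
move=> le_ij lt_j; have lt_i := leq_ltn_trans le_ij lt_j.
have := nth_sort_hooks_gap le_ij lt_j.
have := nth_partition_of_hooks lt_i; have := nth_partition_of_hooks lt_j; lia.
Qed.

(** The count is the height of column [j], and since row lengths decrease the
    rows that meet this column are the first ones. *)
Lemma lt_column_height j p :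
  (p < count (fun l => j < l) k) = (p < size h) && (j < nth 0 k p).
Proof.
set c := count _ _.
have le_c : c <= size h by rewrite -size_partition_of_hooks count_size.
have cE : c = count (fun q => j < nth 0 k q) (iota 0 (size h)).
  rewrite /c -size_partition_of_hooks -[X in count _ X](mkseq_nth 0) count_map.
  exact: eq_count.
have [lt_p|] := ltnP p (size h); last by move=> ge_p; apply/negbTE; lia.
have split_iota : iota 0 (size h) = iota 0 p ++ iota p (size h - p).
  by rewrite -iotaD subnKC // ltnW.
rewrite cE split_iota count_cat.
have [lt_jp|le_pj] := ltnP j (nth 0 k p) => /=.
  have /eqP -> : count (fun q => j < nth 0 k q) (iota 0 p) == p.
    rewrite -[X in _ == X](size_iota 0) -all_count; apply/allP => q.
    rewrite mem_iota => lt_q; apply: leq_trans lt_jp _.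
    by apply: partition_of_hooks_mono; lia.
  rewrite -[X in X < _]addn0 ltn_add2l -has_count; apply/hasP; exists p => //.
  by rewrite mem_iota; lia.
apply/negbTE; rewrite -leqNgt -[X in _ <= X]addn0 leq_add //.
  by rewrite -[X in _ <= X](size_iota 0) count_size.
rewrite leqNgt -has_count; apply/hasPn => q; rewrite mem_iota => q_bnd.
rewrite -leqNgt; apply: leq_trans le_pj; apply: partition_of_hooks_mono; lia.
Qed.

(** The [j]-th nonnegative integer, from 0, that is not in [h]: in the boundary
    word of the partition, whose north steps are numbered by [h], it is the
    position of the east step of column [j]. *)
Definition nth_missing (j : nat) := j + size h - count (fun l => j < l) k.

Lemma column_height_le j : count (fun l => j < l) k <= size h.
Proof. by rewrite -size_partition_of_hooks count_size. Qed.

Lemma nth_missing_mono i j : i < j -> nth_missing i < nth_missing j.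
Proof.
move=> lt_ij; have := column_height_le i; have := column_height_le j.
have : count (fun l => j < l) k <= count (fun l => i < l) k.
  by apply: sub_count => l /=; apply: ltn_trans.
rewrite /nth_missing; lia.
Qed.

Lemma nth_missing_notin j : nth_missing j \notin h.
Proof.
rewrite -(mem_sort geq); apply/(nthP 0) => -[p]; rewrite size_sort => lt_p.
rewrite -nth_partition_of_hooks // /nth_missing.
have := lt_column_height j p; rewrite lt_p /=; have := column_height_le j.
move: (count _ k) (nth 0 k p) (size h) lt_p => c x n; clear.
by case: (ltnP j x); lia.
Qed.

Lemma hook_length_missing i j : i < size h -> j < nth 0 k i ->
  nth_missing j < nth 0 s i /\ hook_length k i j = nth 0 s i - nth_missing j.
Proof.
move=> lt_i lt_j; rewrite -nth_partition_of_hooks // /nth_missing /hook_length.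
have := lt_column_height j i; rewrite lt_i lt_j /=; have := column_height_le j.
move: (count _ k) => c; lia.
Qed.

Lemma hook_length0 i : i < size h -> hook_length k i 0 = nth 0 s i.
Proof.
move=> lt_i; rewrite -(first_column_hooksK h_uniq h_gt0) (nth_map 0).
  by rewrite nth_iota ?size_partition_of_hooks.
by rewrite size_iota size_partition_of_hooks.
Qed.

(** [nth_missing] maps the columns of row [i] injectively to the numbers below
    its first-column hook that are outside [h]; there are as many of them as
    columns because exactly [size h - i.+1] elements of [h] are smaller than
    the hook of row [i]. *)
Lemma perm_missing i : i < size h ->
  perm_eq [seq nth_missing j | j <- iota 0 (nth 0 k i)]
          [seq g <- iota 0 (nth 0 s i) | g \notin h].
Proof.
move=> lt_i; have uniq_missing : uniq [seq nth_missing j | j <- iota 0 (nth 0 k i)].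
  rewrite map_inj_uniq ?iota_uniq // => j j' eq_g.
  by case: (ltngtP j j') => // /nth_missing_mono; rewrite eq_g ltnn.
have sub_missing : {subset [seq nth_missing j | j <- iota 0 (nth 0 k i)]
    <= [seq g <- iota 0 (nth 0 s i) | g \notin h]}.
  move=> _ /mapP[j lt_j ->]; rewrite mem_iota in lt_j.
  rewrite mem_filter nth_missing_notin mem_iota /=.
  by have [] := hook_length_missing lt_i lt_j.
apply: uniq_perm => //; first exact/filter_uniq/iota_uniq.
have [] := uniq_min_size uniq_missing sub_missing; last by [].
rewrite size_map size_iota size_filter.
have := count_predC (mem h) (iota 0 (nth 0 s i)); rewrite size_iota.
have : size (drop i.+1 s) <= count (mem h) (iota 0 (nth 0 s i)).
  rewrite -size_filter; apply: uniq_leq_size; first by rewrite drop_uniq // sort_uniq.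
  move=> x x_s; rewrite mem_filter -[mem h x](mem_sort geq) (mem_drop x_s).
  rewrite mem_iota /=.
  have /(nthP 0)[q] := x_s; rewrite size_drop size_sort nth_drop => lt_q <-.
  have le_iq : i <= i.+1 + q by lia.
  have lt_iq : i.+1 + q < size h by rewrite -ltn_subRL.
  apply: leq_trans (nth_sort_hooks_gap le_iq lt_iq).
  by rewrite -addn1 leq_add2l subn_gt0 addSn ltnS leq_addr.
rewrite size_drop size_sort -(nth_partition_of_hooks lt_i).
by rewrite (eq_count (_ : predC (mem h) =1 fun g => g \notin h)) //; lia.
Qed.

Lemma boundary_in_rowE m i : i < size h ->
  boundary_in_row m k i =
  count (fun g => (g \notin h) && (nth 0 s i - g < m)) (iota 0 (nth 0 s i)).
Proof.
move=> lt_i; transitivity (count (fun g => nth 0 s i - g < m)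
                                [seq nth_missing j | j <- iota 0 (nth 0 k i)]).
  rewrite count_map; apply: eq_in_count => j; rewrite mem_iota => lt_j /=.
  by have [|_ ->] := hook_length_missing lt_i (j := j).
rewrite (permP (perm_missing lt_i)) count_filter; apply: eq_count => g /=.
by rewrite andbC.
Qed.

End Beads.

(** The number of boxes with hook length less than [m] in the row whose
    first-column hook is [h], by [boundary_in_rowE]. *)
Definition row_boundary (m : nat) (H : seq nat) (h : nat) : nat :=
  count (fun g => (g \notin H) && (h - g < m)) (iota 0 h).

Definition class_max (m : nat) (H : seq nat) (h : nat) : bool :=
  all (fun h' => (h' == h %[mod m]) ==> (h' <= h)) H.

Lemma zeta_partitionE a b w (H := positive_hooks a b w) :
  uniq H -> all (leq 1) H ->
  zeta_partition a b w =
  pad a (sort geq [seq row_boundary b H h | h <- H & class_max a H h]).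
Proof.
move=> H_uniq H_gt0; rewrite /zeta_partition /core -/H; congr pad.
set k := partition_of_hooks H; set s := sort geq H.
have szk : size k = size H := size_partition_of_hooks H.
apply/(perm_sortP geq_total geq_trans geq_anti).
apply: (@perm_trans _ [seq row_boundary b H h | h <- s & class_max a H h]); last first.
  by apply/perm_map/perm_filter; rewrite perm_sort.
rewrite -[in X in perm_eq _ X](mkseq_nth 0 s) size_sort /mkseq filter_map.
rewrite -map_comp szk.
have mrowE i : i < size H -> is_mrow a k i = class_max a H (nth 0 s i).
  move=> lt_i; rewrite /is_mrow first_column_hooksK // hook_length0 //.
  by apply: perm_all; rewrite perm_sort.
rewrite (@eq_in_filter _ (is_mrow a k) (preim (nth 0 s) (class_max a H))); last first.
  by move=> i; rewrite mem_iota => /mrowE.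
have /eq_in_map -> // :
  {in [seq i <- iota 0 (size H) | preim (nth 0 s) (class_max a H) i],
    boundary_in_row b k =1 row_boundary b H \o nth 0 s}.
by move=> i; rewrite mem_filter mem_iota => /andP[_ lt_i]; exact: boundary_in_rowE.
Qed.

(** * Sets of boxes closed to the left and upwards *)

(** A partition is determined by its conjugate. *)
Lemma sorted_geq_count_eq s t :
  sorted geq s -> sorted geq t -> size s = size t ->
  (forall j, count (fun x => j < x) s = count (fun x => j < x) t) -> s = t.
Proof.
move=> s_sorted t_sorted eq_sz eq_cnt; apply: (sorted_eq geq_trans geq_anti) => //.
have split x r : count (fun y => x <= y) r = count_mem x r + count (fun y => x < y) r.
  rewrite -count_predUI [X in _ + X](@eq_count _ _ pred0); last first.
    by move=> y /=; case: eqP => // ->; rewrite ltnn.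
  by rewrite count_pred0 addn0; apply: eq_count => y /=; rewrite leq_eqVlt eq_sym.
have eq_cnt' x : count (fun y => x <= y) s = count (fun y => x <= y) t.
  by case: x => [|x]; rewrite ?eq_cnt // !(eq_count (a2 := predT)) ?count_predT.
apply/allP => x _ /=; rewrite -(eqn_add2r (count (fun y => x < y) s)) -split eq_cnt'.
by rewrite split eq_cnt.
Qed.

Lemma pairwise_allpairs (S T U : eqType) (rS : rel S) (rT : rel T) (r : rel U)
    (f : S -> T -> U) xs ys :
  (forall x x' y y', rS x x' -> r (f x y) (f x' y')) ->
  (forall x y y', rT y y' -> r (f x y) (f x y')) ->
  pairwise rS xs -> pairwise rT ys ->
  pairwise r [seq f x y | x <- xs, y <- ys].
Proof.
move=> rS_r rT_r; elim: xs => //= x xs IHxs /andP[x_xs xs_pw] ys_pw.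
rewrite pairwise_cat IHxs // andbT; apply/andP; split; last first.
  by rewrite pairwise_map; apply: sub_pairwise ys_pw => y y'; apply: rT_r.
apply/allrelP => _ _ /mapP[y _ ->] /allpairsP[[x' y'] /= [x'_xs _ ->]].
by apply: rS_r; apply: (allP x_xs).
Qed.

(** An element listed after the cut is in relation [r] with every element listed
    before it. *)
Lemma take_pairwise (T : eqType) (r : rel T) s n x y :
  pairwise r s -> x \in take n s -> y \in s -> ~~ r x y -> y \in take n s.
Proof.
rewrite -{1 3}(cat_take_drop n s) pairwise_cat mem_cat => /andP[/allrelP r_s _] x_s.
by case/orP=> // y_s; rewrite r_s.
Qed.

Lemma mem_downset X x : uniq X ->
  (forall y z, y \in X -> z <= y -> z \in X) -> (x \in X) = (x < size X).
Proof.
move=> X_uniq X_down; apply/idP/idP => [x_X|].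
  rewrite -[x.+1](size_iota 0); apply: uniq_leq_size; first exact: iota_uniq.
  by move=> y; rewrite mem_iota => y_x; apply: X_down x_X _; rewrite -ltnS.
apply: contraLR => x_X; rewrite -leqNgt -[x](size_iota 0).
apply: uniq_leq_size => // y y_X; rewrite mem_iota /= add0n ltnNge.
by apply: contra x_X; apply: X_down.
Qed.

Definition row_count (U : seq (nat * nat)) (y : nat) : nat :=
  count (fun s => s.2 == y) U.

Section Young.

Variables a b : nat.

(** Boxes that form a Young diagram in the upper-left corner of the grid, in
    coordinates where the row above row [y] is row [y.+1]. *)
Definition young_boxes (U : seq (nat * nat)) : Prop :=
  [/\ uniq U, {subset U <= boxes_by_rows a b}
    & forall x y x' y', (x, y) \in U -> 0 < x' <= x -> y <= y' < a ->
        (x', y') \in U].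

Variable U : seq (nat * nat).
Hypothesis U_young : young_boxes U.

Lemma mem_young_row x y : y < a -> (x.+1, y) \in U = (x < row_count U y).
Proof.
have [U_uniq U_sub U_closed] := U_young; move=> lt_y.
pose X := [seq s.1.-1 | s <- U & s.2 == y].
have memX z : (z \in X) = ((z.+1, y) \in U).
  apply/mapP/idP => [[[x' y']]|zU]; last first.
    by exists (z.+1, y); rewrite // mem_filter /= eqxx.
  rewrite mem_filter /= => /andP[/eqP-> xyU ->].
  by have := U_sub _ xyU; rewrite mem_boxes_by_rows => /andP[x_gt0 _]; rewrite prednK.
rewrite -memX /row_count -size_filter -(size_map (fun s => s.1.-1)).
apply: mem_downset.
  rewrite map_inj_in_uniq ?filter_uniq // => -[x1 y1] [x2 y2].
  rewrite !mem_filter /= => /andP[/eqP-> /U_sub] + /andP[/eqP-> /U_sub].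
  by rewrite !mem_boxes_by_rows => /andP[? _] /andP[? _] ?; congr pair; lia.
move=> z z'; rewrite !memX => zU le_z; apply: U_closed zU _ _ => //.
by rewrite leqnn.
Qed.

Lemma young_row_mono y : y.+1 < a -> row_count U y <= row_count U y.+1.
Proof.
move=> lt_y; case def_c: (row_count U y) => [//|c].
have cU : (c.+1, y) \in U by rewrite mem_young_row ?def_c // ltnW.
have [_ _ U_closed] := U_young; rewrite -mem_young_row //.
by apply: U_closed cU _ _; rewrite ?leqnn ?leqnSn.
Qed.

Lemma young_row_diag y : y < a -> a * row_count U y <= b * y.
Proof.
move=> lt_y; case def_c: (row_count U y) => [|c]; first by rewrite muln0.
have cU : (c.+1, y) \in U by rewrite mem_young_row ?def_c.
have [_ U_sub _] := U_young; have := U_sub _ cU.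
by rewrite mem_boxes_by_rows => /and3P[_ _ /ltnW].
Qed.

(** The rows of such a set get longer upwards, and none crosses the diagonal as
    its last box is above it, so they are the rows left of a Dyck path. *)
Lemma young_dyck (a_gt0 : 0 < a) :
  exists Q : dyck a b, bounded Q = [seq row_count U y | y <- rev (iota 0 a)].
Proof.
have [Q rowsQ] := dyck_of_rows a_gt0 young_row_mono young_row_diag.
by exists Q; rewrite /bounded rowsQ map_rev.
Qed.

Lemma young_rows_sorted : sorted geq [seq row_count U y | y <- rev (iota 0 a)].
Proof.
rewrite map_rev rev_sorted; apply/(sortedP 0) => y; rewrite size_map size_iota => lt_y.
have lt_y' := ltnW lt_y; rewrite !(nth_map 0) ?size_iota // !nth_iota //.
exact: young_row_mono.
Qed.

Lemma young_column j :
  count (fun y => j < row_count U y) (iota 0 a) = count (fun s => s.1 == j.+1) U.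
Proof.
have [U_uniq U_sub _] := U_young.
rewrite -!size_filter -(size_map (pair j.+1)); apply/perm_size/uniq_perm.
- by rewrite map_inj_uniq ?filter_uniq ?iota_uniq // => y y' [].
- exact: filter_uniq.
move=> [x y]; rewrite mem_filter /=; apply/mapP/andP => [[y']|[/eqP-> xyU]].
  by rewrite mem_filter mem_iota => /andP[lt_j lt_y] [-> ->]; rewrite mem_young_row.
have := U_sub _ xyU; rewrite mem_boxes_by_rows => /and3P[_ lt_y _].
by exists y; rewrite // mem_filter mem_iota lt_y -mem_young_row // xyU.
Qed.

End Young.

(** * Justified sets and hooks in increasing order *)

Lemma gtn_trans : transitive gtn.
Proof. by move=> y x z /= yx zy; apply: ltn_trans yx. Qed.

Lemma young_take_columns a b n : young_boxes a b (take n (boxes_by_columns a b)).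
Proof.
pose r (s s' : nat * nat) := (s.1 < s'.1) || (s.1 == s'.1) && (s'.2 < s.2).
have r_pw : pairwise r (boxes_by_columns a b).
  apply/pairwise_filter/(@pairwise_allpairs _ _ _ ltn gtn).
  - by move=> x x' y y' /= lt_x; rewrite /r lt_x.
  - by move=> x y y' /= lt_y; rewrite /r eqxx lt_y orbT.
  - by rewrite -sorted_pairwise ?iota_ltn_sorted //; apply: ltn_trans.
  - by rewrite -(sorted_pairwise gtn_trans) rev_sorted iota_ltn_sorted.
split; first by rewrite take_uniq ?uniq_boxes_by_columns.
  by case=> x y /mem_take; rewrite mem_boxes_by_rows mem_boxes_by_columns.
move=> x y x' y' xyU x'_bnd y'_bnd.
apply: (take_pairwise r_pw xyU); last by rewrite /r /=; lia.
have := mem_take xyU; rewrite !mem_boxes_by_columns; nia.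
Qed.

Lemma young_take_rows a b n : young_boxes a b (take n (boxes_by_rows a b)).
Proof.
pose r (s s' : nat * nat) := (s'.2 < s.2) || (s.2 == s'.2) && (s.1 < s'.1).
have r_pw : pairwise r (boxes_by_rows a b).
  apply/pairwise_filter/(@pairwise_allpairs _ _ _ gtn ltn).
  - by move=> y y' x x' /= lt_y; rewrite /r lt_y.
  - by move=> y x x' /= lt_x; rewrite /r eqxx lt_x orbT.
  - by rewrite -(sorted_pairwise gtn_trans) rev_sorted iota_ltn_sorted.
  - by rewrite -sorted_pairwise ?iota_ltn_sorted //; apply: ltn_trans.
split; first by rewrite take_uniq ?uniq_boxes_by_rows.
  by move=> s /mem_take.
move=> x y x' y' xyU x'_bnd y'_bnd.
apply: (take_pairwise r_pw xyU); last by rewrite /r /=; lia.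
have := mem_take xyU; rewrite !mem_boxes_by_rows; nia.
Qed.

Lemma perm_boxes a b : perm_eq (boxes_by_columns a b) (boxes_by_rows a b).
Proof.
apply: uniq_perm; rewrite ?uniq_boxes_by_rows ?uniq_boxes_by_columns //.
by case=> x y; rewrite mem_boxes_by_rows mem_boxes_by_columns.
Qed.

Lemma rev_iota n : rev (iota 0 n) = [seq n - i | i <- iota 1 n].
Proof.
apply: (@eq_from_nth _ 0) => [|i]; rewrite size_rev ?size_map ?size_iota // => lt_i.
by rewrite nth_rev ?size_iota // nth_iota ?(nth_map 0) ?size_iota ?nth_iota //; lia.
Qed.

Lemma iota_rev n : iota 1 n = [seq n - i | i <- rev (iota 0 n)].
Proof.
apply: (@eq_from_nth _ 0) => [|i]; rewrite ?size_map ?size_rev ?size_iota // => lt_i.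
by rewrite (nth_map 0) ?size_rev ?size_iota // nth_rev ?size_iota // !nth_iota; lia.
Qed.

(** The reflection of the plane that keeps the upper-left corner upper left and
    the lower-right corner lower right maps the [a] by [b] grid to the [b] by
    [a] grid.  It preserves hook fillings and takes the order by rows to the
    order by columns. *)
Lemma transpose_boxes a b :
  boxes_by_columns b a = [seq (a - s.2, b - s.1) | s <- boxes_by_rows a b].
Proof.
rewrite /boxes_by_columns iota_rev (rev_iota b) allpairs_mapl allpairs_mapr.
rewrite -(map_allpairs (fun s => (a - s.2, b - s.1)) (fun y x => (x, y))) filter_map.
congr map; apply: eq_in_filter => _ /allpairsP[[y x] /= [ya xb ->]].
rewrite mem_rev !mem_iota in ya xb; rewrite /above_diag /= !mulnBr (mulnC b a).
have le_x : a * x <= a * b by rewrite leq_mul2l; apply/orP; right; lia.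
have le_y : b * y <= a * b by rewrite mulnC leq_mul2r; apply/orP; right; lia.
lia.
Qed.

Section Gaps.

Variables a b : nat.
Hypotheses (a_gt0 : 0 < a) (b_gt0 : 0 < b) (coprime_ab : coprime a b).

Local Notation G := (grid_hooks a b).

(** In row [y], with [q = b * y %/ a], the hook of column [x] has quotient
    [q - x] by [a].  So the quotients in this row are 0, ..., q - 1, like the
    column indices counted from 0, but in the opposite order.  Both lists are
    therefore the same up to order, and both are sorted. *)
Lemma columns_hooks :
  [seq s.1.-1 | s <- boxes_by_columns a b] = [seq h %/ a | h <- sort leq G].
Proof.
apply: (sorted_eq leq_trans anti_leq).
- pose r (s s' : nat * nat) := s.1 <= s'.1.
  rewrite sorted_map; apply: pairwise_sorted; apply/pairwise_filter.
  apply: (@pairwise_allpairs _ _ _ leq (fun _ _ => true)).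
  + by move=> x x' y y' /=; lia.
  + by move=> x y y' /=.
  + by rewrite -(sorted_pairwise leq_trans) iota_sorted.
  + by elim: (rev _) => //= y ys ->; rewrite andbT; apply/allP.
- rewrite sorted_map; apply: sub_sorted (sort_sorted leq_total G) => h h'.
  exact: leq_div2r.
(* The reflection of each row exchanges the column index with the quotient. *)
pose phi (s : nat * nat) := (b * s.2 %/ a - s.1 + 1, s.2).
have hook_phi s :
    s \in boxes_by_rows a b -> hook_filling a b s %/ a = (phi s).1.-1.
  case: s => x y; rewrite mem_boxes_by_rows /hook_filling /= => /and3P[_ _ lt_xy].
  by rewrite (mulnC a x) divnBMl addn1.
have phi_in s :
    s \in boxes_by_rows a b -> phi s \in boxes_by_rows a b /\ phi (phi s) = s.
  case: s => x y; rewrite !mem_boxes_by_rows => /and3P[x_gt0 lt_y lt_xy].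
  have r_gt0 : 0 < (b * y) %% a.
    rewrite lt0n; apply: contraTneq lt_xy => r0.
    have -> : y = 0; last by rewrite muln0.
    apply: (mulb_modn_inj a_gt0 b_gt0 coprime_ab) => //.
    by rewrite muln0 mod0n r0.
  have := divn_eq (b * y) a; set q := _ %/ _.
  move: (_ %% _) r_gt0 (ltn_pmod (b * y) a_gt0) => r r_gt0 lt_r def_by.
  have le_xq : x <= q by nia.
  rewrite lt_y /=; split; last by rewrite /phi /= -/q; congr pair; lia.
  have le_q : (q - x + 1) * a <= q * a by rewrite leq_mul2r; apply/orP; right; lia.
  by rewrite (mulnC a) addn1 /= -addn1 def_by; lia.
apply: (@perm_trans _ [seq s.1.-1 | s <- boxes_by_rows a b]).
  exact: perm_map (perm_boxes a b).
apply: (@perm_trans _ [seq s.1.-1 | s <- map phi (boxes_by_rows a b)]).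
  apply: perm_map; apply: uniq_perm; first exact: uniq_boxes_by_rows.
    rewrite map_inj_in_uniq ?uniq_boxes_by_rows // => s s'.
    move=> /phi_in[_ phiK] /phi_in[_ phiK'] eq_phi.
    by rewrite -phiK eq_phi.
  move=> s; apply/idP/mapP => [sB|[s' /phi_in[phiB _] ->]] //.
  by have [phiB phiK] := phi_in _ sB; exists (phi s).
have -> : [seq s.1.-1 | s <- map phi (boxes_by_rows a b)] = [seq h %/ a | h <- G].
  by rewrite -!map_comp; apply/eq_in_map => s /hook_phi.
by apply: perm_map; rewrite perm_sym perm_sort.
Qed.

Lemma hook_gt0 h : h \in G -> 0 < h.
Proof. by case/grid_hooksP => [? [? []]]. Qed.

(** For [n > 0] the bound [t] is the [n]-th smallest hook.  It has to be a hook
    itself, as the conjugate path is described by the largest hook. *)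
Lemma smallest_hooks_threshold n : n <= size G ->
  exists t, perm_eq (smallest_hooks a b n) [seq h <- G | h <= t]
         /\ (if n is 0 then t = 0 else t \in G).
Proof.
rewrite /smallest_hooks; set s := sort leq G => le_n.
have s_sorted : sorted ltn s.
  by rewrite ltn_sorted_uniq_leq sort_uniq uniq_grid_hooks // (sort_sorted leq_total).
have memS h : (h \in s) = (h \in G) by rewrite mem_sort.
have sz_s : size s = size G by rewrite size_sort.
case: n le_n => [|m] lt_m.
  exists 0; split; rewrite // take0 (eq_in_filter (a2 := pred0)) ?filter_pred0 //.
  by move=> h /hook_gt0; rewrite leqn0 lt0n => /negbTE.
exists (nth 0 s m); split; last by rewrite -memS mem_nth ?sz_s.
have ltn_nth := sorted_ltn_nth ltn_trans 0 s_sorted.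
apply: uniq_perm; first by rewrite take_uniq ?sort_uniq ?uniq_grid_hooks.
  by rewrite filter_uniq ?uniq_grid_hooks.
move=> h; rewrite mem_filter -memS; apply/idP/andP.
  move=> h_take; split; last exact: mem_take h_take.
  have /(nthP 0)[i] := h_take; rewrite size_takel ?sz_s // => lt_i <-.
  rewrite nth_take //; move: lt_i; rewrite ltnS leq_eqVlt => /predU1P[->//|lt_im].
  by apply/ltnW/ltn_nth; rewrite ?inE ?sz_s ?(ltn_trans lt_im lt_m).
case=> le_h /(nthP 0)[i]; rewrite sz_s => lt_i def_h; rewrite -def_h in le_h *.
have le_im : i < m.+1.
  rewrite ltnNge; apply: contraL le_h => lt_mi; rewrite -ltnNge.
  by apply: ltn_nth; rewrite ?inE ?sz_s.
by rewrite -(nth_take 0 le_im) mem_nth // size_takel ?sz_s.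
Qed.

Lemma take_columns_count n j :
  count (fun s => s.1 == j.+1) (take n (boxes_by_columns a b))
  = count (fun h => h %/ a == j) (smallest_hooks a b n).
Proof.
rewrite -(count_map (fun h => h %/ a) (pred1 j)) map_take -columns_hooks -map_take.
rewrite count_map; apply: eq_in_count => -[x y] /mem_take.
by rewrite mem_boxes_by_columns /= => /andP[x_gt0 _]; lia.
Qed.

End Gaps.

(** This is [take_columns_count] for the transposed grid, in which the row at
    height [a.-1 - j] becomes the column with index [j]. *)
Lemma take_rows_count a b n j : 0 < a -> 0 < b -> coprime a b -> j < a ->
  row_count (take n (boxes_by_rows a b)) (a.-1 - j)
  = count (fun h => h %/ b == j) (smallest_hooks a b n).
Proof.
move=> a_gt0 b_gt0 cop_ab lt_j.
have <- : smallest_hooks b a n = smallest_hooks a b n.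
  congr take; apply/(perm_sortP leq_total leq_trans anti_leq)/uniq_perm.
  - by rewrite uniq_grid_hooks // coprime_sym.
  - exact: uniq_grid_hooks.
  - by move=> v; rewrite [RHS]mem_grid_hooks_sym.
rewrite -take_columns_count ?transpose_boxes 1?coprime_sym // -map_take count_map.
apply: eq_in_count => -[x y] /mem_take.
by rewrite mem_boxes_by_rows /= => /and3P[_ lt_y _]; lia.
Qed.

(** * The zeta map on a truncation of the set of gaps *)

Lemma sorted_pad m s : sorted geq s -> sorted geq (pad m s).
Proof.
move=> s_sorted; rewrite (sorted_pairwise geq_trans) pairwise_cat.
rewrite -!(sorted_pairwise geq_trans) s_sorted.
have -> : sorted geq (nseq (m - size s) 0).
  rewrite (sorted_pairwise geq_trans).
  by elim: (_ - _) => //= i ->; rewrite all_nseq /= orbT.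
by rewrite !andbT; apply/allrelP => x y _ /nseqP[-> _].
Qed.

Lemma count_pad j m s : count (fun x => j < x) (pad m s) = count (fun x => j < x) s.
Proof. by rewrite count_cat count_nseq mul0n addn0. Qed.

Lemma pad_sort_prefix (c : nat -> nat) m k L : k <= m ->
  sorted geq [seq c j | j <- iota 0 m] -> (forall j, k <= j < m -> c j = 0) ->
  perm_eq L [seq c j | j <- iota 0 k] ->
  pad m (sort geq L) = [seq c j | j <- iota 0 m].
Proof.
move=> le_km; rewrite -{1 4}(subnKC le_km) iotaD map_cat add0n => c_sorted c0 permL.
have -> : sort geq L = [seq c j | j <- iota 0 k].
  apply/(sorted_eq geq_trans geq_anti).
  - exact: sort_sorted geq_total L.
  - by move: c_sorted; rewrite !(sorted_pairwise geq_trans) pairwise_cat => /and3P[].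
  - by rewrite perm_sort.
rewrite /pad size_map size_iota; congr cat.
rewrite -[in LHS](size_iota k (m - k)) -(size_map c); apply/esym/all_pred1P.
apply/allP => x /mapP[j j_iota ->]; rewrite /= c0 //.
by move: j_iota; rewrite mem_iota; lia.
Qed.

Section Gaps.

Variables a b : nat.
Hypotheses (a_gt0 : 0 < a) (b_gt0 : 0 < b) (coprime_ab : coprime a b).

Local Notation G := (grid_hooks a b).
Local Notation gap_sum := (grid_hook_not_sum a_gt0 b_gt0 coprime_ab).
Local Notation nongap_sum := (not_grid_hook_sum a_gt0 coprime_ab).

Lemma sum_notin_gaps i j : i * a + j * b \notin G.
Proof. by apply/negP => /gap_sum/(_ erefl). Qed.

Lemma gap_lt_ab h : h \in G -> h < a * b.
Proof. by case/grid_hooksP=> x [y [? ? ? ?]]; nia. Qed.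

Lemma gap_sub h i j : h \in G -> i * a + j * b <= h -> h - (i * a + j * b) \in G.
Proof.
move=> hG le_h; apply/contraT => /nongap_sum[i' [j' [_ def_h]]].
by case: (gap_sum (i := i + i') (j := j + j') hG); lia.
Qed.

Lemma nongap_sum' g : g \notin G -> exists i j, i < b /\ g = i * a + j * b.
Proof.
rewrite mem_grid_hooks_sym // => /not_grid_hook_sum[]; rewrite 1?coprime_sym //.
by move=> j [i [lt_i ->]]; exists i, j; rewrite addnC.
Qed.

Lemma multiples_modn_inj i i' : i < b -> i' < b -> i * a = i' * a %[mod b] -> i = i'.
Proof.
rewrite !(mulnC _ a); by apply: mulb_modn_inj; rewrite // coprime_sym.
Qed.

Section Truncation.

Variables (t : nat) (H : seq nat).
Hypotheses (H_uniq : uniq H) (memH : forall h, (h \in H) = (h <= t) && (h \in G)).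

(** Every element of the semigroup is [i * a + j * b] with [i < b], and these
    [i * a] are pairwise incongruent modulo [b].  So the window of length [b]
    that ends at [h] contains exactly one element of the semigroup for each [i]
    with [i * a <= h]. *)
Lemma row_boundary_truncation h : h \in H -> row_boundary b H h = (h %/ a).+1.
Proof.
rewrite memH => /andP[le_ht hG].
have ia_le i : (i < (h %/ a).+1) = (i * a <= h) by rewrite ltnS leq_divRL.
have lt_ib i : i * a <= h -> i < b.
  move=> le_i; rewrite -(ltn_pmul2r a_gt0); apply: leq_ltn_trans le_i _.
  by rewrite mulnC; apply: gap_lt_ab.
(* The element of the window below [h] that is congruent to [i * a]. *)
pose g i := h - (h - i * a) %% b.
have g_sum i : i * a <= h -> g i = i * a + (h - i * a) %/ b * b.
  move=> le_i; have := divn_eq (h - i * a) b; rewrite /g.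
  by move: (_ %/ _) (_ %% _) => q r; lia.
rewrite /row_boundary -size_filter -[RHS](size_iota 0) -(size_map g).
apply/esym/perm_size/uniq_perm; last 1 first.
- move=> x; rewrite mem_filter mem_iota memH; apply/mapP/idP.
    case=> i; rewrite mem_iota /= add0n ia_le => le_i ->.
    have := g_sum i le_i; have := ltn_pmod (h - i * a) b_gt0.
    have : g i \notin G by rewrite g_sum ?sum_notin_gaps.
    have : g i <> h.
      by apply/eqP; apply: contraTneq hG => <-; rewrite g_sum ?sum_notin_gaps.
    by rewrite /g => ? /negbTE-> ? ?; rewrite andbF /=; lia.
  rewrite -andbA => /and3P[notH lt_b lt_h]; rewrite add0n in lt_h.
  have le_xt : x <= t by apply: leq_trans (ltnW lt_h) le_ht.
  rewrite le_xt /= in notH; have [i [j [lt_i def_x]]] := nongap_sum' notH.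
  exists i; first by rewrite mem_iota /= add0n ia_le; lia.
  have -> : g i = h - (j * b + (h - x)) %% b by rewrite /g; congr (_ - _ %% _); lia.
  by rewrite modnMDl modn_small //; lia.
- rewrite map_inj_in_uniq ?iota_uniq // => i i'.
  rewrite !mem_iota /= !add0n !ia_le => le_i le_i'.
  rewrite !g_sum // => eq_g; apply: multiples_modn_inj; rewrite ?lt_ib //.
  by rewrite -(modnMDl ((h - i * a) %/ b)) addnC eq_g addnC modnMDl.
- exact/filter_uniq/iota_uniq.
Qed.

(** In a residue class modulo [a] the hooks are all the numbers up to the
    largest one, because gaps are closed under subtraction of [a].  So a class
    has a hook with quotient [j] when the quotient of its largest hook is at
    least [j]. *)
Lemma class_max_count j :
  count (fun h => class_max a H h && (j <= h %/ a)) H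
  = count (fun h => h %/ a == j) H.
Proof.
have downH h i : h \in H -> i * a <= h -> h - i * a \in H.
  rewrite !memH => /andP[le_h hG] le_i; have := @gap_sub h i 0 hG.
  by rewrite addn0 => -> //; rewrite andbT (leq_trans (leq_subr _ _)).
(* The element with quotient [j] in the residue class of [h]. *)
pose f h := h %% a + j * a.
have f_mod h : f h = h %[mod a] by rewrite /f addnC modnMDl modn_mod.
rewrite -!size_filter -[LHS](size_map f); apply/perm_size/uniq_perm.
- rewrite map_inj_in_uniq ?filter_uniq // => h h'.
  rewrite !mem_filter => /andP[/andP[/allP h_max _] hH].
  move=> /andP[/andP[/allP h'_max _] h'H] eq_f.
  have eq_m : h = h' %[mod a] by rewrite -f_mod eq_f f_mod.
  apply/eqP; rewrite eqn_leq.
  by have := h_max h' h'H; have := h'_max h hH; rewrite /= eq_m eqxx /= => -> ->.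
- exact: filter_uniq.
move=> x; rewrite mem_filter; apply/mapP/andP => [[h]|[/eqP x_j xH]].
  rewrite mem_filter => /andP[/andP[_ le_j] hH] ->.
  rewrite /f addnC divnMDl // divn_small ?ltn_pmod // addn0; split=> //.
  have def_h := divn_eq h a; have := downH h (h %/ a - j) hH.
  have -> : h - (h %/ a - j) * a = j * a + h %% a.
    have : j * a <= h %/ a * a by rewrite leq_mul2r le_j orbT.
    by rewrite mulnBl; move: (h %/ a) (h %% a) def_h => q r; lia.
  by apply; rewrite (leq_trans _ (leq_divM h a)) // leq_mul2r leq_subr orbT.
pose in_class m := (m \in H) && (m == x %[mod a]).
have x_class : exists m, in_class m by exists x; rewrite /in_class xH eqxx.
have class_le m : in_class m -> m <= t by rewrite /in_class memH => /andP[/andP[]].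
case: (ex_maxnP x_class class_le) => m /andP[mH /eqP m_x] m_max.
have le_m h : h \in H -> h = x %[mod a] -> h <= m.
  by move=> hH h_x; apply: m_max; rewrite /in_class hH h_x eqxx.
exists m; last by rewrite /f m_x -x_j addnC -divn_eq.
rewrite mem_filter mH andbT; apply/andP; split; last by rewrite -x_j leq_div2r // le_m.
by apply/allP => h hH; apply/implyP => /eqP h_m; apply: le_m; rewrite ?h_m.
Qed.

End Truncation.

(** * The zeta map on the conjugate of a truncation *)

Section Conjugate.

Variables (M : nat) (H Hc : seq nat).
Hypotheses (M_gap : M \in G) (Hc_uniq : uniq Hc).
Hypothesis memH : forall h, (h \in H) = (h <= M) && (h \in G).
Hypothesis memHc : forall h, (h \in Hc) = (0 < h <= M) && (M - h \notin H).

(** Up to [M] the numbers that are not hooks are those of the semigroup. *)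
Lemma mem_conjugate_truncation h : (h \in Hc) = (0 < h <= M) && (M - h \notin G).
Proof. by rewrite memHc memH leq_subr. Qed.

Lemma row_of_multiple j : (j < (M %/ b).+1) = (j * b <= M).
Proof. by rewrite ltnS leq_divRL. Qed.

Lemma multiple_lt j : j * b <= M -> j < a.
Proof.
move=> le_j; rewrite -(ltn_pmul2r b_gt0); apply: leq_ltn_trans le_j _.
exact: gap_lt_ab.
Qed.

Lemma sub_multiple_conj j : j * b <= M -> M - j * b \in Hc.
Proof.
move=> le_j; rewrite mem_conjugate_truncation subKn // (sum_notin_gaps 0 j).
rewrite andbT leq_subr andbT.
rewrite subn_gt0 ltn_neqAle le_j andbT; apply: contraTneq M_gap => <-.
exact: (sum_notin_gaps 0 j).
Qed.

(** A number [h = M - (i * a + j * b)] is not the largest of its residue class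
    modulo [a] if [i > 0], since then [h + a] has the same form.  It is the
    largest if [i = 0], since [j < a], so that subtracting a positive multiple of
    [a] from [j * b] never gives an element of the semigroup. *)
Lemma perm_class_max_conj :
  perm_eq [seq h <- Hc | class_max a Hc h]
          [seq M - j * b | j <- iota 0 (M %/ b).+1].
Proof.
apply: uniq_perm; first exact: filter_uniq.
  rewrite map_inj_in_uniq ?iota_uniq // => j j'.
  rewrite !mem_iota !add0n !row_of_multiple.
  move=> /andP[_ le_j] /andP[_ le_j'] eq_j.
  apply/eqP; rewrite -(eqn_pmul2r b_gt0).
  by rewrite -(subKn le_j) eq_j subKn.
move=> h; rewrite mem_filter; apply/andP/mapP => [[/allP h_max hHc]|[j]].
  have := hHc; rewrite mem_conjugate_truncation => /andP[h_bnd].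
  move=> /nongap_sum[i [j [_ def_h]]].
  exists j; first by rewrite mem_iota add0n row_of_multiple; lia.
  case: i def_h => [|i] def_h; first by lia.
  have haHc : h + a \in Hc.
    have -> : h + a = M - (i * a + j * b) by lia.
    by rewrite mem_conjugate_truncation subKn ?sum_notin_gaps; lia.
  by have := h_max _ haHc; rewrite modnDr eqxx /= leqNgt; lia.
rewrite mem_iota add0n row_of_multiple => le_j ->.
split; last exact: sub_multiple_conj.
apply/allP => h'; rewrite mem_conjugate_truncation => /andP[h'_bnd].
move=> /nongap_sum[i' [j' [lt_j' def_h']]].
apply/implyP => /eqP eq_m; rewrite leqNgt; apply/negP => lt_h.
have dv : a %| h' - (M - j * b) by rewrite -eqn_mod_dvd ?eq_m // ltnW.
have [k def_k] := dvdnP dv.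
have def_j : j * b = (k + i') * a + j' * b by lia.
have eq_j : j' = j.
  apply: (mulb_modn_inj a_gt0 b_gt0 coprime_ab) => //; first exact: multiple_lt.
  by rewrite !(mulnC b) def_j modnMDl.
by rewrite eq_j in def_j; nia.
Qed.

(** The reflection [g |-> M - g] maps the window below [M - j * b] to the numbers
    between [j * b] and [j.+1 * b], and exchanges the numbers outside [Hc] with
    those in [H]. *)
Lemma row_boundary_conj j : uniq H -> j * b <= M ->
  row_boundary b Hc (M - j * b) = count (fun h => h %/ b == j) H.
Proof.
move=> H_uniq le_j; rewrite /row_boundary -!size_filter -[LHS](size_map (subn M)).
apply/perm_size/uniq_perm; last 1 first.
- move=> u; rewrite [RHS]mem_filter memH; apply/mapP/andP => [[g]|].
    rewrite mem_filter mem_iota mem_conjugate_truncation add0n.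
    move=> /andP[/andP[notHc lt_b] lt_g] ->.
    have uG : M - g \in G.
      apply: contraNT notHc => notG; rewrite notG andbT.
      by case: (posnP g) notG => [->|]; rewrite ?subn0 ?M_gap //; lia.
    rewrite uG leq_subr; split=> //; apply/eqP.
    have -> : M - g = j * b + (M - j * b - g) by lia.
    by rewrite divnMDl // divn_small ?addn0.
  case=> /eqP u_j /andP[le_u uG]; exists (M - u); last by rewrite subKn.
  have neq_u : u != j * b by apply: contraTneq uG => ->; apply: (sum_notin_gaps 0 j).
  have := divn_eq u b; have := ltn_pmod u b_gt0; rewrite u_j => lt_r def_u.
  rewrite mem_filter mem_iota mem_conjugate_truncation subKn // uG andbF /=.
  by move: (u %% b) lt_r def_u => r; lia.
- rewrite map_inj_in_uniq ?filter_uniq ?iota_uniq // => g g'.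
  by rewrite !mem_filter !mem_iota; lia.
- exact: filter_uniq.
Qed.

End Conjugate.

End Gaps.

(** * The path of smallest hooks and its images *)

Section Paths.

Variables a b : nat.
Hypotheses (a_gt0 : 0 < a) (b_gt0 : 0 < b) (coprime_ab : coprime a b).
Implicit Type P Q : dyck a b.

Local Notation G := (grid_hooks a b).

Lemma mem_hooks_row P x y v : y < a -> 0 < v -> v + a * x = b * y ->
  (v \in positive_hooks a b P) = (nth 0 (row_lengths P) y < x).
Proof.
move=> lt_y v_gt0 def_v; apply/positive_hooksP/idP => [|lt_x]; last by exists x, y.
case=> x' [y' [lt_x' lt_y' _ def_v']].
by have [-> ->] := hook_eq_inj a_gt0 b_gt0 coprime_ab lt_y lt_y' def_v def_v'.
Qed.

(** If the row of [Q] extended beyond that of [P], the last box of this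
    difference would have a hook that belongs to [P] alone. *)
Lemma positive_hooks_inj P Q :
  positive_hooks a b P =i positive_hooks a b Q -> P = Q.
Proof.
move=> eqH; apply: bounded_inj; congr rev.
apply: (@eq_from_nth _ 0) => [|y]; rewrite !size_row_lengths !dyck_north // => lt_y.
wlog suff le_rows : P Q eqH / nth 0 (row_lengths Q) y <= nth 0 (row_lengths P) y.
  by apply/eqP; rewrite eqn_leq !le_rows.
rewrite leqNgt; apply/negP => lt_rows.
have := dyck_row Q lt_y; set x := nth 0 (row_lengths Q) y => le_x.
have neq_by : a * x <> b * y.
  move=> eq_xy; have y0 : y = 0.
    apply: (mulb_modn_inj a_gt0 b_gt0 coprime_ab) => //.
    by rewrite -eq_xy muln0 mod0n mulnC modnMl.
  move/eqP: eq_xy; rewrite y0 muln0 muln_eq0 (gtn_eqF a_gt0) /= => /eqP x0.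
  by rewrite -/x x0 in lt_rows.
have def_v : b * y - a * x + a * x = b * y by rewrite subnK.
have v_gt0 : 0 < b * y - a * x by lia.
have := eqH (b * y - a * x); rewrite !(mem_hooks_row _ lt_y v_gt0 def_v) ltnn.
by rewrite lt_rows.
Qed.

(** In row [y] the boxes with hook greater than [t] are those of the first
    [(b * y - t.+1) %/ a] columns. *)
Lemma truncation_dyck t :
  exists P : dyck a b,
    forall h, (h \in positive_hooks a b P) = (h <= t) && (h \in G).
Proof.
have [|y lt_y|P rowsP] := @dyck_of_rows a b (fun y => (b * y - t.+1) %/ a) a_gt0.
- by move=> y _; apply: leq_div2r; rewrite mulnS; lia.
- rewrite mulnC; apply: leq_trans (leq_divM _ _) _; exact: leq_subr.
exists P => h.
have nth_row y : y < a -> nth 0 (row_lengths P) y = (b * y - t.+1) %/ a.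
  by move=> lt_y; rewrite rowsP (nth_map 0) ?size_iota // nth_iota.
apply/positive_hooksP/andP => [[x [y [lt_x lt_y h_gt0 def_h]]]|].
  split; last first.
    by apply/grid_hooksP; exists x, y; split=> //; apply: leq_ltn_trans lt_x.
  by move: lt_x; rewrite nth_row // ltn_divLR //; nia.
case=> le_h /grid_hooksP[x [y [x_gt0 lt_y h_gt0 def_h]]]; exists x, y; split=> //.
by rewrite nth_row // ltn_divLR //; nia.
Qed.

Lemma path_hooks_gt0 P : all (leq 1) (positive_hooks a b P).
Proof. by apply/allP => h /positive_hooksP[x [y []]]. Qed.

Lemma zeta_bounding P Q : bounded Q = zeta_partition a b P -> zeta P = Q.
Proof.
rewrite /zeta => <-; case: pickP => [Q' /eqP/bounded_inj|] //.
by move/(_ Q); rewrite eqxx.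
Qed.

Lemma perm_truncation_hooks n t P :
  perm_eq (smallest_hooks a b n) [seq h <- G | h <= t] ->
  (forall h, (h \in positive_hooks a b P) = (h <= t) && (h \in G)) ->
  perm_eq (positive_hooks a b P) (smallest_hooks a b n).
Proof.
move=> perm_n memP; rewrite perm_sym; apply: perm_trans perm_n _.
apply: uniq_perm; first by rewrite filter_uniq ?uniq_grid_hooks.
  exact: uniq_positive_hooks.
by move=> h; rewrite memP mem_filter.
Qed.

(** Partitions with the same column heights are equal, and for both sides the
    height of column [j] is the number of hooks of [P] with quotient [j] by
    [a]. *)
Lemma zeta_truncation n t P :
  perm_eq (smallest_hooks a b n) [seq h <- G | h <= t] ->
  (forall h, (h \in positive_hooks a b P) = (h <= t) && (h \in G)) ->
  zeta_partition a b P = left_justified a b n.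
Proof.
move=> perm_n memP; have uniqP := uniq_positive_hooks a_gt0 b_gt0 coprime_ab P.
have permP := perm_truncation_hooks perm_n memP.
rewrite zeta_partitionE ?path_hooks_gt0 //; set L := [seq _ | h <- _ & _].
have U_young := @young_take_columns a b n.
have cntL j : count (fun x => j < x) L
    = count (fun h => h %/ a == j) (smallest_hooks a b n).
  rewrite /L count_map count_filter -(seq.permP permP).
  rewrite -(class_max_count a_gt0 b_gt0 coprime_ab uniqP memP).
  apply: eq_in_count => h hH /=; rewrite andbC; congr andb.
  by rewrite (row_boundary_truncation a_gt0 b_gt0 coprime_ab uniqP memP).
(* All parts are positive, and the first column has at most [a] boxes. *)
have szL : size L <= a.
  have <- : count (fun x => 0 < x) L = size L.
    apply/eqP; rewrite -all_count; apply/allP => r /mapP[h].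
    rewrite mem_filter => /andP[_ hH] -> /=.
    by rewrite (row_boundary_truncation a_gt0 b_gt0 coprime_ab uniqP memP).
  rewrite cntL -take_columns_count // -(young_column U_young).
  exact: leq_trans (count_size _ _) (eq_leq (size_iota 0 a)).
apply: sorted_geq_count_eq.
- exact/sorted_pad/(sort_sorted geq_total).
- exact: young_rows_sorted U_young.
- rewrite size_cat size_nseq size_sort subnKC //.
  by rewrite /left_justified size_map size_rev size_iota.
move=> j; rewrite count_pad count_sort cntL -take_columns_count //.
rewrite -(young_column U_young).
by rewrite /left_justified count_map count_rev.
Qed.

(** In both partitions the row [j], from the top, is the number of hooks of [P]
    with quotient [j] by [b].  The core of the conjugate path provides only the
    rows with [j * b <= t], and the rows below are empty. *)
Lemma zeta_conjugate_truncation n t P :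
  perm_eq (smallest_hooks a b n) [seq h <- G | h <= t] ->
  (if n is 0 then t = 0 else t \in G) ->
  (forall h, (h \in positive_hooks a b P) = (h <= t) && (h \in G)) ->
  zeta_partition a b (conjugate P) = up_justified a b n.
Proof.
move=> perm_n t_spec memP; have uniqP := uniq_positive_hooks a_gt0 b_gt0 coprime_ab P.
have permP := perm_truncation_hooks perm_n memP.
pose c j := count (fun h => h %/ b == j) (positive_hooks a b P).
have upE : up_justified a b n = [seq c j | j <- iota 0 a].
  rewrite /up_justified; apply: (@eq_from_nth _ 0) => [|j].
    by rewrite !size_map size_rev.
  rewrite size_map size_rev size_iota => lt_j.
  rewrite !(nth_map 0) ?size_rev ?size_iota // nth_rev ?size_iota //.
  rewrite !nth_iota ?subn_gt0 //; last by lia.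
  have -> : 0 + (a - j.+1) = a.-1 - j by lia.
  by rewrite /c (seq.permP permP) -take_rows_count.
have c_sorted : sorted geq [seq c j | j <- iota 0 a].
  by rewrite -upE; apply: young_rows_sorted (@young_take_rows a b n).
rewrite upE zeta_partitionE ?path_hooks_gt0 ?uniq_positive_hooks //.
case: n {perm_n upE} t_spec permP => [_|m tG _].
  rewrite /smallest_hooks take0 => /perm_nilP P0.
  rewrite (hooks_conjugate_nil a_gt0 b_gt0 coprime_ab P0).
  by apply: (@pad_sort_prefix c a 0) => // j _; rewrite /c P0.
have memC v : (v \in positive_hooks a b (conjugate P))
    = (0 < v <= t) && (t - v \notin positive_hooks a b P).
  apply: mem_hooks_conjugate => //; first by rewrite memP leqnn tG.
  by move=> h; rewrite memP => /andP[].
have uniqC := uniq_positive_hooks a_gt0 b_gt0 coprime_ab (conjugate P).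
apply: (@pad_sort_prefix c a (t %/ b).+1) => //.
- by rewrite ltn_divLR //; apply: gap_lt_ab tG.
- move=> j /andP[le_j _]; apply/eqP; rewrite eqn0Ngt -has_count; apply/hasPn => h.
  rewrite memP => /andP[le_h _]; apply: contraL le_j => /eqP <-.
  by rewrite -ltnNge ltnS leq_div2r.
have perm_max := perm_class_max_conj a_gt0 b_gt0 coprime_ab tG uniqC memP memC.
apply: perm_trans (perm_map _ perm_max) _.
rewrite -map_comp; set Hc := positive_hooks a b _.
suff /eq_in_map -> :
  {in iota 0 (t %/ b).+1, row_boundary b Hc \o (fun j => t - j * b) =1 c} by [].
move=> j; rewrite mem_iota add0n ltnS leq_divRL // => /andP[_ le_j].
exact: (row_boundary_conj a_gt0 b_gt0 coprime_ab tG uniqC memP memC).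
Qed.

End Paths.

Theorem proposition6p13 (a b n : nat) (a_gt0 : 0 < a) (b_gt0 : 0 < b)
    (coprime_ab : coprime a b) (zeta_bij : bijective (@zeta a b))
    (le_n : n <= size (boxes_by_rows a b)) :
  exists Q : dyck a b,
    [/\ bounded Q = left_justified a b n,
        bounded (chi zeta_bij Q) = up_justified a b n &
        unique (fun P : dyck a b =>
                  area a b P = n /\
                  perm_eq (positive_hooks a b P) (smallest_hooks a b n))
               (zeta_inv zeta_bij Q)].
Proof.
have le_nG : n <= size (grid_hooks a b) by rewrite size_map.
have [t [perm_n t_spec]] := smallest_hooks_threshold a_gt0 b_gt0 coprime_ab le_nG.
have [P memP] := truncation_dyck a_gt0 b_gt0 coprime_ab t.
have [Q Q_left] := young_dyck (@young_take_columns a b n) a_gt0.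
have [Qc Qc_up] := young_dyck (@young_take_rows a b n) a_gt0.
have zetaP : zeta P = Q.
  apply: zeta_bounding.
  by rewrite (zeta_truncation a_gt0 b_gt0 coprime_ab perm_n memP).
have inv_Q : zeta_inv zeta_bij Q = P by rewrite -zetaP /zeta_inv invF_f.
have permP := perm_truncation_hooks a_gt0 b_gt0 coprime_ab perm_n memP.
exists Q; split=> //.
  rewrite /chi inv_Q; have -> // : zeta (conjugate P) = Qc.
  apply: zeta_bounding.
  by rewrite (zeta_conjugate_truncation a_gt0 b_gt0 coprime_ab perm_n t_spec memP).
rewrite inv_Q; split.
  by split=> //; rewrite /area (perm_size permP) size_takel ?size_sort.
move=> P' [_ permP']; apply: (positive_hooks_inj a_gt0 b_gt0 coprime_ab) => h.
by rewrite (perm_mem permP) (perm_mem permP').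
Qed.
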